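(* Let $(X,d,\mu)$ be a bounded doubling metric measure space, let $p\in\mathbb{P}(X)$, put $p_-=\inf_{x\in X}p(x)$, and let $\varrho$ be a weight on $X$ satisfying $$\sup_{x\in X,\ r>0}\left(\frac{1}{\mu B(x,r)}\int_{B(x,r)}|\varrho(y)|^{p(y)}\,d\mu(y)\right)\left(\frac{1}{\mu B(x,r)}\int_{B(x,r)}\frac{d\mu(y)}{|\varrho(y)|^{\frac{p(y)}{p_--1}}}\right)^{p_--1}<\infty .$$ Then the Hardy-Littlewood maximal operator $\mathcal{M}$ is bounded in $L^{p(\cdot)}(X,\varrho)$, i.e. there is a constant $C>0$ such that $\|\mathcal{M}f\|_{L^{p(\cdot)}(X,\varrho)}\le C\|f\|_{L^{p(\cdot)}(X,\varrho)}$ for all $f\in L^{p(\cdot)}(X,\varrho)$.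
   Context: A doubling metric measure space $(X,d,\mu)$ (space of homogeneous type) is a set $X$ with a quasimetric $d$ (that is, $d\ge 0$, $d(x,y)=0$ iff $x=y$, $d(x,y)=d(y,x)$, and $d(x,y)\le c_0[d(x,z)+d(z,y)]$ for a constant $c_0\ge 1$) and a non-negative Borel regular measure $\mu$ for which all balls $B(x,r)=\{y\in X: d(x,y)<r\}$ are measurable with $0<\mu B(x,r)<\infty$ and the doubling condition $\mu B(x,2r)\le C\mu B(x,r)$ holds with $C$ independent of $x\in X$ and $r>0$. $X$ is bounded if $\operatorname{diam}X=\sup_{x,y\in X}d(x,y)<\infty$. $\mathbb{P}(X)$ is the set of bounded measurable functions $p:X\to\mathbb{R}$ such that $1<p_-\le p(x)\le p^+<\infty$ for all $x\in X$, where $p_-=\inf_{x\in X}p(x)$ and $p^+=\sup_{x\in X}p(x)$, and for some constant $A>0$ $$|p(x)-p(y)|\le\frac{A}{\ln\frac{1}{d(x,y)}}\quad\text{for all } x,y\in X \text{ with } 0<d(x,y)\le \tfrac12 .$$ A weight is a measurable function $\varrho\ge 0$ on $X$, positive and finite $\mu$-almost everywhere. $L^{p(\cdot)}(X,\varrho)$ is the space of measurable $f:X\to\mathbb{C}$ with $$\|f\|_{L^{p(\cdot)}(X,\varrho)}=\inf\left\{\lambda>0:\int_X\left|\frac{\varrho(x)f(x)}{\lambda}\right|^{p(x)}d\mu(x)\le 1\right\}<\infty .$$ The maximal operator is $\displaystyle \mathcal{M}f(x)=\sup_{r>0}\frac{1}{\mu B(x,r)}\int_{B(x,r)}|f(y)|\,d\mu(y)$,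 $x\in X$. *)

(* Defs.v *)
From HB Require Import structures.
From mathcomp Require Import all_boot all_order all_algebra.
From mathcomp Require Import complex.
From mathcomp Require Import all_classical all_reals all_analysis.
From mathcomp Require Import measurable_realfun.

Set Implicit Arguments.
Unset Strict Implicit.
Unset Printing Implicit Defensive.
Import Order.TTheory GRing.Theory Num.Theory.
Import numFieldNormedType.Exports.
Local Open Scope classical_set_scope.
Local Open Scope ring_scope.

Record quasimetric (R : realType) (T : Type) (d : T -> T -> R) : Prop := {
  quasimetric_ge0 : forall x y, 0 <= d x y ;
  quasimetric_eq0 : forall x y, d x y = 0 <-> x = y ;
  quasimetric_sym : forall x y, d x y = d y x ;
  quasimetric_tri : exists2 c0 : R, 1 <= c0 &
    forall x y z, d x y <= c0 * (d x z + d z y) }.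

Definition qball (R : realType) (T : Type) (d : T -> T -> R) (x : T) (r : R) :
  set T := [set y | d x y < r].

(* The topology of a quasimetric: its balls form a neighbourhood basis at each
   point but need not be open themselves. *)
Definition qopen (R : realType) (T : Type) (d : T -> T -> R) : set (set T) :=
  [set U | forall x, U x -> exists2 r : R, 0 < r & qball d x r `<=` U].

Definition qborel (R : realType) (T : Type) (d : T -> T -> R) : set (set T) :=
  <<s qopen d >>.

Definition diam (R : realType) (T : Type) (d : T -> T -> R) : \bar R :=
  ereal_sup [set (d xy.1 xy.2)%:E | xy in [set: T * T]].

Definition borel_regular (R : realType) (disp : measure_display)
    (T : measurableType disp) (d : T -> T -> R)
    (mu : {measure set T -> \bar R}) : Prop :=
  qborel d `<=` measurable /\
  forall A, measurable A ->
    exists B, [/\ qborel d B, A `<=` B & mu B = mu A].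

Record homogeneous_space (R : realType) (disp : measure_display)
    (T : measurableType disp) (d : T -> T -> R)
    (mu : {measure set T -> \bar R}) : Prop := {
  homogeneous_quasimetric : quasimetric d ;
  homogeneous_regular : borel_regular d mu ;
  homogeneous_measurable : forall x r, measurable (qball d x r) ;
  homogeneous_ball : forall x r, 0 < r -> (0 < mu (qball d x r) < +oo)%E ;
  homogeneous_doubling : exists C : R, forall x r, 0 < r ->
    (mu (qball d x (2 * r)) <= C%:E * mu (qball d x r))%E }.

Definition pminus (R : realType) (T : Type) (p : T -> R) : R := inf (range p).

Definition pplus (R : realType) (T : Type) (p : T -> R) : R := sup (range p).

(* [inf] and [sup] of an unbounded set of reals take a default value, hence the
   separate boundedness requirement. *)
Record log_exponent (R : realType) (disp : measure_display)
    (T : measurableType disp) (d : T -> T -> R) (p : T -> R) : Prop := {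
  log_exponent_measurable : measurable_fun [set: T] p ;
  log_exponent_bounded : has_lbound (range p) /\ has_ubound (range p) ;
  log_exponent_pminus : 1 < pminus p ;
  log_exponent_range : forall x, pminus p <= p x <= pplus p ;
  log_exponent_log : exists2 A : R, 0 < A &
    forall x y, 0 < d x y <= 1 / 2 -> `|p x - p y| <= A / ln (1 / d x y) }.

(* A weight is finite only almost everywhere, hence extended-valued. *)
Record weight (R : realType) (disp : measure_display)
    (T : measurableType disp) (mu : {measure set T -> \bar R})
    (rho : T -> \bar R) : Prop := {
  weight_measurable : measurable_fun [set: T] rho ;
  weight_ge0 : forall x, (0 <= rho x)%E ;
  weight_ae : {ae mu, forall x, (0 < rho x < +oo)%E} }.

(* Luxemburg norm. The argument is extended-valued so that it applies both to
   |f| and to M f, which may be infinite. The library integral of a nonnegative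
   function is the supremum of the integrals of the nonnegative simple functions
   below it; it is also defined on nonmeasurable functions. *)
Definition luxnorm (R : realType) (disp : measure_display)
    (T : measurableType disp) (mu : {measure set T -> \bar R})
    (p : T -> R) (rho : T -> \bar R) (g : T -> \bar R) : \bar R :=
  ereal_inf [set lambda%:E | lambda in
    [set lambda : R | 0 < lambda /\
      (\int[mu]_x (`|rho x * g x / lambda%:E| `^ p x) <= 1)%E]].

Definition cabs (R : realType) (T : Type) (f : T -> R[i]) : T -> \bar R :=
  fun x => (ComplexField.Normc.normc (f x))%:E.

Definition Lpvar (R : realType) (disp : measure_display)
    (T : measurableType disp) (mu : {measure set T -> \bar R})
    (p : T -> R) (rho : T -> \bar R) : set (T -> R[i]) :=
  [set f : T -> R[i] | [/\
    measurable_fun [set: T] (fun x => complex.Re (f x)),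
    measurable_fun [set: T] (fun x => complex.Im (f x)) &
    (luxnorm mu p rho (cabs f) < +oo)%E]].

Definition average (R : realType) (disp : measure_display)
    (T : measurableType disp) (mu : {measure set T -> \bar R})
    (B : set T) (g : T -> \bar R) : \bar R :=
  ((mu B)^-1 * \int[mu]_(y in B) g y)%E.

Definition maximal (R : realType) (disp : measure_display)
    (T : measurableType disp) (d : T -> T -> R)
    (mu : {measure set T -> \bar R}) (f : T -> R[i]) (x : T) : \bar R :=
  ereal_sup [set average mu (qball d x r) (cabs f) | r in [set r : R | 0 < r]].

Definition weight_const (R : realType) (disp : measure_display)
    (T : measurableType disp) (d : T -> T -> R)
    (mu : {measure set T -> \bar R}) (p : T -> R) (rho : T -> \bar R) : \bar R :=
  ereal_sup [set
    (average mu (qball d xr.1 xr.2) (fun y => `|rho y| `^ p y) *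
     average mu (qball d xr.1 xr.2)
       (fun y => (`|rho y| `^ (p y / (pminus p - 1)%R))^-1) `^ (pminus p - 1)%R)%E
    | xr in [set xr : T * R | 0 < xr.2]].

(* Main.v *)
Require Import Defs.
From HB Require Import structures.
From mathcomp Require Import all_boot all_order all_algebra.
From mathcomp Require Import complex.
From mathcomp Require Import all_classical all_reals all_analysis.
From mathcomp Require Import measurable_realfun.
From mathcomp Require Import ring lra.
Set Implicit Arguments.
Unset Strict Implicit.
Unset Printing Implicit Defensive.
Import Order.TTheory GRing.Theory Num.Theory.
Import numFieldNormedType.Exports.
Local Open Scope classical_set_scope.
Local Open Scope ring_scope.

(** Write [q] for [pminus p], [w] for [rho `^ p] and [sg] for
    [w `^ (- (q - 1)^-1)].  The hypothesis on [rho] is the Muckenhoupt condition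
    A_q for [w].  The proof has three ingredients.

    Discretization.  A bounded doubling space is totally bounded
    ([finite_net]), so there is a countable family of balls, the cells, such
    that every ball is contained in a cell of comparable measure
    ([ball_in_cell]).  The maximal operator is then dominated by
    [family_maximal], the supremum of the averages over the cells containing a
    point.  This majorant is measurable, whereas the maximal function itself
    need not be, quasimetric balls not being open in general.

    Constant exponent.  For a measure that is doubling along the cells, a
    Vitali selection gives the weak type (1,1) bound, and cutting the function
    at dyadic heights turns it into a bound in every L^s, s > 1
    ([strong_type]).  The A_q condition makes the measures [w mu] and [sg mu]
    doubling, and Lerner's pointwise inequality bounds the unweighted maximal
    function of [g] to the power [q - 1] by the maximal function relative to
    [w mu] of (the maximal function relative to [sg mu] of [g / sg], to the
    power [q - 1], divided by [w]).  Two applications of [strong_type], with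
    the exponents [q / (q - 1)] and [q], give Muckenhoupt's theorem
    ([muckenhoupt]) without self-improvement of the A_q condition.

    Variable exponent.  Let the integral of [g `^ p * w] be at most 1.  On a
    cell containing [x] the average of [g], raised to the power [p x / q], is at
    most a constant times 1 plus the average of [g `^ (p / q)]
    ([average_pow_le]).  Indeed the average of [g] is at most polynomial in
    the inverse of the scale of the cell, since [sg] is integrable and
    measures of balls decay at most polynomially, and by the logarithmic
    condition such a quantity raised to the power [p x - p y] stays bounded
    for [y] in the cell.  Taking suprema and applying [muckenhoupt] to
    [g `^ (p / q)] bounds the integral of [(M g) `^ p * w]; homogeneity of the
    norm concludes. *)

(** * Integrals of nonnegative functions and measures with a density *)

Section integrals.
Context (R : realType) (disp : measure_display) (T : measurableType disp).
Local Open Scope ereal_scope.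

(** The integral of a nonnegative function is a supremum over the simple
    functions below it, hence monotone on arbitrary functions, among them
    [maximal d mu f]. *)
Lemma le_lower_integral (mu : {measure set T -> \bar R}) (D : set T)
    (f g : T -> \bar R) :
  (forall x, D x -> 0 <= f x) -> (forall x, D x -> f x <= g x) ->
  \int[mu]_(x in D) f x <= \int[mu]_(x in D) g x.
Proof.
move=> f0 fg.
have g0 x : D x -> 0 <= g x by move=> Dx; exact: le_trans (f0 x Dx) (fg x Dx).
rewrite !ge0_integralE//; apply: le_ereal_sup => _ [h hf <-].
exists h => // x; apply: le_trans (hf x) _.
by apply: lee_restrict => // y Dy; exact: f0.
Qed.

Lemma le_lower_integral_set (mu : {measure set T -> \bar R}) (D E : set T)
    (f : T -> \bar R) :
  (forall x, 0 <= f x) -> D `<=` E ->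
  \int[mu]_(x in D) f x <= \int[mu]_(x in E) f x.
Proof.
move=> f0 DE; rewrite integral_mkcond [leRHS]integral_mkcond.
apply: le_lower_integral => x _; first exact: erestrict_ge0.
rewrite !patchE; case: ifPn => [|_]; last by case: ifPn.
by rewrite inE => /DE xE; rewrite mem_set.
Qed.

(** The majorant is raised to [+oo] on the exceptional null set, so that [f] is
    bounded everywhere and only [g] has to be split. *)
Lemma ae_le_lower_integral (mu : {measure set T -> \bar R}) (D : set T)
    (f g : T -> \bar R) :
  measurable D -> measurable_fun D g ->
  (forall x, 0 <= f x) -> (forall x, 0 <= g x) ->
  {ae mu, forall x, f x <= g x} ->
  \int[mu]_(x in D) f x <= \int[mu]_(x in D) g x.
Proof.
move=> mD mg f0 g0 [N [mN N0 fgN]].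
pose h := (cst +oo : T -> \bar R) \_ N \+ g.
apply: (@le_trans _ _ (\int[mu]_(x in D) h x)).
  apply: le_lower_integral => // x _; rewrite /h /= patchE.
  case: ifPn => [_|].
    rewrite /= addye ?leey//; last by rewrite -ltNye (lt_le_trans _ (g0 x)).
  rewrite notin_setE add0e => Nx; apply: contrapT => fg; apply: Nx.
  exact: fgN.
rewrite /h ge0_integralD//; last 2 first.
- by move=> x _; apply: erestrict_ge0 => y _; exact: leey.
- apply: measurable_funTS; apply/(measurable_restrictT _ mN).1.
  exact: measurable_cst.
rewrite -integral_mkcondr null_set_integral ?add0e//; first exact: measurableI.
by apply: (subset_measure0 _ _ _ N0) => //; exact: measurableI.
Qed.

(** Dually, the measurable minorant is cut off on the exceptional set. *)
Lemma le_ae_lower_integral (mu : {measure set T -> \bar R}) (D : set T)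
    (f g : T -> \bar R) :
  measurable D -> measurable_fun D f ->
  (forall x, 0 <= f x) -> (forall x, 0 <= g x) ->
  {ae mu, forall x, f x <= g x} ->
  \int[mu]_(x in D) f x <= \int[mu]_(x in D) g x.
Proof.
move=> mD mf f0 g0 [N [mN N0 fgN]].
rewrite (ge0_negligible_integral mN)//.
apply: (@le_trans _ _ (\int[mu]_(x in D `\` N) g x)).
  apply: le_lower_integral => // x [_ Nx]; apply: contrapT => fg; apply: Nx.
  exact: fgN.
by apply: le_lower_integral_set => // x [].
Qed.

End integrals.

Section density.
Context (R : realType) (disp : measure_display) (T : measurableType disp).
Local Open Scope ereal_scope.

(** The positivity and measurability proofs are arguments so that the measure
    structure can be found by unification. *)
Definition density (mu : {measure set T -> \bar R}) (u : T -> R)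
    (mu_u : measurable_fun setT u) (u0 : forall x, (0 <= u x)%R) : set T -> \bar R :=
  fun A => \int[mu]_(x in A) (u x)%:E.

Variables (mu : {measure set T -> \bar R}) (u : T -> R).
Hypothesis mu_u : measurable_fun setT u.
Hypothesis u0 : forall x, (0 <= u x)%R.

Let density0 : density mu mu_u u0 set0 = 0.
Proof. by rewrite /density integral_set0. Qed.

Let density_ge0 A : 0 <= density mu mu_u u0 A.
Proof. by apply: integral_ge0 => x _; rewrite lee_fin. Qed.

Let density_sigma_additive : semi_sigma_additive (density mu mu_u u0).
Proof.
move=> F mF tF mUF; rewrite /density ge0_integral_bigcup//.
- by apply: is_cvg_ereal_nneg_natsum_cond => n _ _; exact: density_ge0.
- by apply/measurable_EFinP; exact: measurable_funTS.
- by move=> x _; rewrite lee_fin.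
Qed.

HB.instance Definition _ := isMeasure.Build _ _ _ (density mu mu_u u0)
  density0 density_ge0 density_sigma_additive.

Let mEu : measurable_fun setT (EFin \o u).
Proof. exact/measurable_EFinP. Qed.

Import HBNNSimple.

Lemma integral_density_nnsfun (h : {nnsfun T >-> R}) :
  \int[density mu mu_u u0]_x (h x)%:E = \int[mu]_x ((h x)%:E * (u x)%:E).
Proof.
under [LHS]eq_integral do rewrite fimfunE -fsumEFin//.
rewrite [LHS]ge0_integral_fsum//; last 2 first.
  - by move=> r; exact/measurable_EFinP/measurable_funM.
  - by move=> n x _; rewrite EFinM nnfun_muleindic_ge0.
under [RHS]eq_integral.
  move=> x xD; rewrite fimfunE -fsumEFin// ge0_mule_fsuml; last first.
    by move=> r; rewrite EFinM nnfun_muleindic_ge0.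
  over.
rewrite [RHS]ge0_integral_fsum//; last 2 first.
  - move=> r; apply: emeasurable_funM => //.
    exact/measurable_EFinP/measurable_funM.
  - by move=> n x _; apply: mule_ge0; [exact: nnfun_muleindic_ge0|rewrite lee_fin].
apply: eq_fsbigr => r _; rewrite integralZl_indic_nnsfun//= integral_indic//.
under [RHS]eq_integral do rewrite EFinM -muleA.
have [r0|r0] := leP 0%R r; last first.
  have -> : h @^-1` [set r] = set0 by exact: preimage_nnfun0.
  rewrite set0I measure0 mule0 integral0_eq// => x _.
  by rewrite indic0 mul0e mule0.
rewrite ge0_integralZl//; last 2 first.
- by apply: emeasurable_funM => //; exact/measurable_EFinP.
- by move=> x _; rewrite mule_ge0// lee_fin.
congr (_ * _); rewrite setIT /= /density [LHS]integral_mkcond.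
apply: eq_integral => x _; rewrite patchE indicE.
by case: ifPn; rewrite ?mul1e ?mul0e.
Qed.

Lemma integral_density (f : T -> \bar R) :
  measurable_fun setT f -> (forall x, 0 <= f x) ->
  \int[density mu mu_u u0]_x f x = \int[mu]_x (f x * (u x)%:E).
Proof.
move=> mf f0; pose f_ := nnsfun_approx measurableT mf.
have f_cvg x : (f_ n x)%:E @[n --> \oo] --> f x by exact: cvg_nnsfun_approx.
have f_nd x : {homo (fun n => f_ n x) : m n / (m <= n)%N >-> (m <= n)%R}.
  by move=> m n mn; exact/lefP/nd_nnsfun_approx.
transitivity (limn (fun n => \int[density mu mu_u u0]_x (f_ n x)%:E)).
  rewrite -monotone_convergence//=.
  - by apply: eq_integral => x _; apply/esym/cvg_lim => //=.
  - by move=> n; apply: measurableT_comp.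
  - by move=> n x _; rewrite lee_fin.
  - by move=> x _ a b ab; rewrite lee_fin//; exact: f_nd.
under eq_fun do rewrite integral_density_nnsfun.
rewrite -monotone_convergence//=.
- apply: eq_integral => x _; apply/cvg_lim => //.
  under eq_fun do rewrite muleC.
  by rewrite muleC; apply: cvgeZl.
- move=> n; apply: emeasurable_funM => //; exact: measurableT_comp.
- by move=> n x _; rewrite mule_ge0 ?lee_fin.
- move=> x _ a b ab; rewrite lee_wpmul2r ?lee_fin//.
  exact: f_nd.
Qed.

Lemma integral_density_set (D : set T) (f : T -> \bar R) :
  measurable D -> measurable_fun setT f -> (forall x, 0 <= f x) ->
  \int[density mu mu_u u0]_(x in D) f x = \int[mu]_(x in D) (f x * (u x)%:E).
Proof.
move=> mD mf f0; rewrite [LHS]integral_mkcond (integral_density (f := f \_ D)); last 2 first.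
- by apply/(measurable_restrictT f mD).1; exact: measurable_funTS.
- by move=> x; exact: erestrict_ge0.
rewrite [RHS]integral_mkcond; apply: eq_integral => x _.
by rewrite !patchE; case: ifPn => //; rewrite mul0e.
Qed.

End density.

(** * The maximal function of a countable family of sets *)

Section family_maximal.
Context (R : realType) (disp : measure_display) (T : measurableType disp).
Variables (nu : {measure set T -> \bar R}) (Q : nat -> set T).
Local Open Scope ereal_scope.

(** A supremum over the members that contain the point, written with indicators
    so that it is a countable supremum of measurable functions. *)
Definition family_maximal (f : T -> \bar R) (x : T) : \bar R :=
  ereal_sup (range (fun j => average nu (Q j) f * (\1_(Q j) x)%:E)).

Lemma average_ge0 (B : set T) (f : T -> \bar R) :
  (forall x, 0 <= f x) -> 0 <= average nu B f.
Proof. by move=> f0; rewrite mule_ge0 ?inve_ge0// integral_ge0. Qed.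

Variable f : T -> \bar R.
Hypothesis f0 : forall x, 0 <= f x.

Lemma average_le_family_maximal j x :
  Q j x -> average nu (Q j) f <= family_maximal f x.
Proof.
move=> Qx; apply: ereal_sup_ubound; exists j => //.
by rewrite indicE mem_set// mule1.
Qed.

Lemma family_maximal_ge0 x : 0 <= family_maximal f x.
Proof.
apply: (@le_trans _ _ (average nu (Q 0%N) f * (\1_(Q 0%N) x)%:E)).
  by rewrite mule_ge0 ?average_ge0// lee_fin.
by apply: ereal_sup_ubound; exists 0%N.
Qed.

Lemma family_maximal_le x y : 0 <= y ->
  (forall j, Q j x -> average nu (Q j) f <= y) -> family_maximal f x <= y.
Proof.
move=> y0 h; apply: ge_ereal_sup => _ [j _ <-]; rewrite indicE.
by have [/set_mem/h|_] := boolP (x \in Q j); rewrite ?mule1 ?mule0.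
Qed.

Lemma lt_family_maximal x y : 0 <= y ->
  y < family_maximal f x -> exists2 j, Q j x & y < average nu (Q j) f.
Proof.
move=> y0 /ereal_sup_gt[_ [j _ <-]]; rewrite indicE.
have [/set_mem Qx|_] := boolP (x \in Q j); rewrite ?mule1 ?mule0; last by rewrite ltNge y0.
by exists j.
Qed.

Lemma measurable_family_maximal :
  (forall j, measurable (Q j)) -> measurable_fun setT (family_maximal f).
Proof.
move=> mQ; rewrite (_ : family_maximal f =
  fun x => esups (fun j => average nu (Q j) f * (\1_(Q j) x)%:E) 0%N).
  apply: measurable_fun_esups => j; apply: emeasurable_funM => //.
  exact/measurable_EFinP.
by apply/funext => x; rewrite /esups /sdrop /family_maximal;
  congr ereal_sup; apply/seteqP; split => _ [j _ <-]; exists j.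
Qed.

End family_maximal.

Section vitali.
Context (T : Type) (Q Qs : nat -> set T) (lev : nat -> nat).
Hypothesis Qsub : forall i, Q i `<=` Qs i.
Hypothesis Qmeet : forall i j,
  (lev j <= lev i)%N -> Q i `&` Q j !=set0 -> Q i `<=` Qs j.

(** Greedy selection: a member of least level engulfs, once enlarged, all the
    members that it meets; those are discarded and the selection goes on. *)
Lemma vitali_selection (s : seq nat) : exists s' : seq nat,
  [/\ uniq s', {subset s' <= s}, trivIset [set` s'] Q &
    forall i, i \in s -> exists2 j, j \in s' & Q i `<=` Qs j].
Proof.
have [n] := ubnP (size s); elim: n s => // n IHn s sn.
have [->|s0] := eqVneq s [::].
  by exists [::]; split => // i j; rewrite /= ?in_nil.
have [j js jmin] : exists2 j, j \in s & forall i, i \in s -> (lev j <= lev i)%N.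
  pose P k := has (fun i => lev i == k) s.
  have exP : exists k, P k.
    case: s s0 {sn} @P => // a s _; exists (lev a).
    by rewrite /= eqxx.
  case: (ex_minnP exP) => m /hasP[j js /eqP <-] hm.
  exists j => // i si; apply: hm; apply/hasP; by exists i.
pose s1 := [seq i <- s | (i != j) && ~~ `[< Q i `&` Q j !=set0 >]].
have s1s : (size s1 < size s)%N.
  rewrite size_filter -(count_predC (fun i => (i != j) && ~~ `[< Q i `&` Q j !=set0 >]) s).
  rewrite -[X in (X < _)%N]addn0 ltn_add2l -has_count; apply/hasP; exists j => //=.
  by rewrite eqxx.
have [t [ut ts tI tQ]] := IHn s1 (leq_trans s1s sn).
have tj i : i \in t -> i != j /\ ~ (Q i `&` Q j !=set0).
  by move=> /ts; rewrite mem_filter => /andP[/andP[? /asboolPn ?] _].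
exists (j :: t); split => /=.
- by rewrite ut andbT; apply/negP => /tj[]; rewrite eqxx.
- move=> i; rewrite inE => /predU1P[->//|/ts].
  by rewrite mem_filter => /andP[].
- move=> a b /=; rewrite !inE => /predU1P[->|ta] /predU1P[->|tb] //.
  + by rewrite setIC => /(tj b tb).2.
  + by move=> /(tj a ta).2.
  + exact: tI.
- move=> i si; have [->|ij] := eqVneq i j; first by exists j; rewrite ?mem_head.
  have [m|m] := pselect (Q i `&` Q j !=set0).
    by exists j; [rewrite mem_head|apply: Qmeet => //; exact: jmin].
  have /tQ[k kt Qk] : i \in s1 by rewrite mem_filter ij si andbT; exact/asboolPn.
  by exists k; rewrite // inE kt orbT.
Qed.

End vitali.

Section weak_type.
Context (R : realType) (disp : measure_display) (T : measurableType disp).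
Variables (nu : {measure set T -> \bar R}) (Q Qs : nat -> set T).
Variables (lev : nat -> nat) (K : R).
Local Open Scope ereal_scope.
Hypothesis mQ : forall j, measurable (Q j).
Hypothesis mQs : forall j, measurable (Qs j).
Hypothesis Qsub : forall i, Q i `<=` Qs i.
Hypothesis Qmeet : forall i j,
  (lev j <= lev i)%N -> Q i `&` Q j !=set0 -> Q i `<=` Qs j.
Hypothesis K0 : (0 <= K)%R.
Hypothesis nuQs : forall j, nu (Qs j) <= K%:E * nu (Q j).

Let weak_type_seq (f : T -> \bar R) (lam : R) (s : seq nat) :
  measurable_fun setT f -> (forall x, 0 <= f x) -> (0 <= lam)%R ->
  (forall j, j \in s -> lam%:E * nu (Q j) <= \int[nu]_(x in Q j) f x) ->
  lam%:E * nu (\big[setU/set0]_(j <- s) Q j) <= K%:E * \int[nu]_x f x.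
Proof.
move=> mf f0 lam0 h.
have [t [ut ts tI tQ]] := vitali_selection Qsub Qmeet s.
have bigs (u : seq nat) : nu (\big[setU/set0]_(j <- u) Qs j) <=
    \sum_(j <- u) nu (Qs j).
  elim: u => [|a u IHu]; first by rewrite !big_nil measure0.
  rewrite !big_cons; apply: (le_trans (measureU2 _ _ _)) => //.
    exact: bigsetU_measurable.
  exact: leeD.
apply: (@le_trans _ _ (lam%:E * \sum_(j <- t) nu (Qs j))).
  apply: lee_wpmul2l; rewrite ?lee_fin//; apply: le_trans (bigs t).
  apply: le_measure; rewrite ?inE; try exact: bigsetU_measurable.
  rewrite -!bigcup_seq => x [i /= /tQ[j jt Qij] Qx].
  by exists j => //; exact: Qij.
rewrite ge0_sume_distrr//.
apply: (@le_trans _ _ (\sum_(j <- t) K%:E * \int[nu]_(x in Q j) f x)).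
  rewrite big_seq [leRHS]big_seq; apply: lee_sum => j jt.
  apply: (@le_trans _ _ (K%:E * (lam%:E * nu (Q j)))).
    by rewrite muleCA; apply: lee_wpmul2l; rewrite ?lee_fin.
  by apply: lee_wpmul2l; rewrite ?lee_fin//; exact/h/ts.
rewrite -ge0_sume_distrr//; last by move=> *; exact: integral_ge0.
apply: lee_wpmul2l; rewrite ?lee_fin//.
rewrite -ge0_integral_bigsetU//; last exact: measurable_funTS.
exact: le_lower_integral_set.
Qed.

(** Weak type (1,1): the selected members are disjoint, and their enlargements
    cover the union at the cost of the doubling constant.  The large averages
    are those of a subfamily [S] fixed in advance, so that the bound can be
    applied to a truncation of the function that defines [S]. *)
Lemma weak_type (f : T -> \bar R) (lam : R) (S : set nat) :
  measurable_fun setT f -> (forall x, 0 <= f x) -> (0 <= lam)%R ->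
  (forall j, S j -> lam%:E * nu (Q j) <= \int[nu]_(x in Q j) f x) ->
  lam%:E * nu (\bigcup_(j in S) Q j) <= K%:E * \int[nu]_x f x.
Proof.
move=> mf f0 lam0 h.
pose F n := \big[setU/set0]_(j <- [seq j <- iota 0 n | `[< S j >]]) Q j.
have FE n : F n = \bigcup_(j in [set j | (j < n)%N /\ S j]) Q j.
  rewrite /F -bigcup_seq; apply/seteqP; split => x [j /=].
    by rewrite mem_filter mem_iota => /andP[/asboolP ? ?] ?; exists j.
  move=> [jn Sj] Qx; exists j => //=; rewrite mem_filter mem_iota add0n jn.
  by rewrite !andbT; exact/asboolP.
have FU : \bigcup_(j in S) Q j = \bigcup_n F n.
  apply/seteqP; split => x.
    by move=> [j Sj Qx]; exists j.+1 => //; rewrite FE; exists j.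
  by move=> [n _]; rewrite FE => -[j [_ Sj] Qx]; exists j.
have mF n : measurable (F n) by exact: bigsetU_measurable.
have ndF : nondecreasing_seq F.
  move=> m n mn; apply/subsetPset; rewrite !FE => x [j [jm Sj] Qx].
  by exists j => //; split => //; exact: leq_trans mn.
have cF : lam%:E * nu (F n) @[n --> \oo] --> lam%:E * nu (\bigcup_n F n).
  apply: cvgeZl => //; apply: nondecreasing_cvg_mu => //.
  exact: bigcup_measurable.
rewrite FU -(cvg_lim _ cF)//; apply: lime_le; first by apply/cvg_ex; eexists; exact: cF.
apply: nearW => n; apply: weak_type_seq => // j.
by rewrite mem_filter => /andP[/asboolP/h].
Qed.

End weak_type.

(** * Strong type inequality *)

Section truncation.
Context (R : realType) (T : Type).
Local Open Scope ereal_scope.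

Definition truncation (t : R) (f : T -> \bar R) (x : T) : \bar R :=
  if t%:E < f x then f x else 0.

Lemma truncation_ge0 t f : (forall x, 0 <= f x) -> forall x, 0 <= truncation t f x.
Proof. by move=> f0 x; rewrite /truncation; case: ifPn. Qed.

Lemma le_truncation t f x : (0 <= t)%R -> f x <= t%:E + truncation t f x.
Proof.
move=> t0; rewrite /truncation; case: ltP => h; last by rewrite adde0.
by rewrite leeDr// lee_fin.
Qed.

End truncation.

Section truncated_average.
Context (R : realType) (disp : measure_display) (T : measurableType disp).
Variable nu : {measure set T -> \bar R}.
Local Open Scope ereal_scope.

Lemma measurable_truncation (t : R) (f : T -> \bar R) :
  measurable_fun setT f -> measurable_fun setT (truncation t f).
Proof.
move=> mf; apply: measurable_fun_ifT => //.
apply: (measurable_fun_bool true).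
rewrite setTI -[X in measurable X]setTI; exact: emeasurable_fun_o_infty.
Qed.

Lemma averageE (B : set T) (f : T -> \bar R) : 0 < nu B < +oo ->
  average nu B f = (fine (nu B))^-1%:E * \int[nu]_(x in B) f x.
Proof.
move=> /andP[B0 Boo]; rewrite /average -[in LHS](fineK (x := nu B)).
  by rewrite inver gt_eqF// fine_gt0// B0.
by rewrite ge0_fin_numE.
Qed.

(** The values at most [t] contribute at most [t], half of the average. *)
Lemma truncated_average (B : set T) (f : T -> \bar R) (t : R) :
  measurable B -> 0 < nu B < +oo -> measurable_fun setT f ->
  (forall x, 0 <= f x) -> (0 <= t)%R ->
  (2 * t)%:E <= average nu B f ->
  t%:E * nu B <= \int[nu]_(x in B) truncation t f x.
Proof.
move=> mB nuB mf f0 t0; rewrite averageE//.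
have /andP[B0 Boo] := nuB.
have Bfin : nu B \is a fin_num by rewrite ge0_fin_numE.
rewrite lee_pdivlMl; last by rewrite fine_gt0// B0.
rewrite fineK// muleC => h.
have {h} : (2 * t)%:E * nu B <= t%:E * nu B + \int[nu]_(x in B) truncation t f x.
  apply: (le_trans h).
  rewrite -(integral_cst nu mB t%:E) -ge0_integralD//; last 2 first.
  - by move=> x _; rewrite truncation_ge0.
  - by apply: measurable_funTS; exact: measurable_truncation.
  by apply: le_lower_integral => // x _; exact: le_truncation.
rewrite -[nu B](fineK Bfin) -!EFinM -mulrA mulr_natl mulr2n EFinD.
by rewrite leeD2lE.
Qed.

End truncated_average.

Section geometric.
Context (R : realType).
Local Open Scope ereal_scope.

Lemma gt1_powR2 (s : R) : (1 < s)%R -> (1 < 2 `^ (s - 1))%R.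
Proof.
move=> s1; rewrite -[ltLHS](powRr0 2) /powR ?pnatr_eq0/= ltr_expR mul0r mulr_gt0//.
  by rewrite subr_gt0.
by rewrite ln_gt0// ltr1n.
Qed.

(** The geometric sum is dominated by its last term, the one of the largest
    power of 2 below the point. *)
Lemma geometric_truncation (s : R) (y : \bar R) : (1 < s)%R -> 0 <= y ->
  \sum_(0 <= k <oo) ((2 `^ (s - 1)) ^+ k)%:E *
     (if (2 ^+ k)%:E < y then y else 0) <=
  (2 `^ (s - 1) / (2 `^ (s - 1) - 1))%:E * y `^ s.
Proof.
move=> s1 y0; set a := (2 `^ (s - 1))%R.
have a1 : (1 < a)%R by exact: gt1_powR2.
have a0 : (0 < a)%R by exact: lt_trans a1.
have ca : (0 < a / (a - 1))%R by rewrite divr_gt0// subr_gt0.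
case: y y0 => [y y0|_|//]; last first.
  by rewrite poweRyr ?gt_eqF ?(lt_trans _ s1)// gt0_muley ?leey// lte_fin.
rewrite lee_fin in y0.
apply: lime_le.
  apply: is_cvg_nneseries => k _ _; apply: mule_ge0; last by case: ifPn.
  by rewrite lee_fin exprn_ge0// ltW.
apply: nearW => n.
rewrite (_ : \sum_(0 <= k < n) _ =
  (\sum_(0 <= k < n) a ^+ k * (if (2 ^+ k < y)%R then y else 0))%:E); last first.
  by rewrite -sumEFin; apply: eq_bigr => k _; rewrite lte_fin EFinM; case: ifP.
rewrite poweR_EFin -EFinM lee_fin.
elim: n => [|n IHn].
  by rewrite big_geq// mulr_ge0 ?powR_ge0// ltW.
rewrite big_nat_recr//=; case: ifPn => [ny|_]; last by rewrite mulr0 addr0.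
rewrite -[X in (_ + X)%R]/(a ^+ n * y)%R.
apply: (@le_trans _ _ (\sum_(0 <= k < n.+1) a ^+ k * y)%R).
  rewrite big_nat_recr//= lerD2r; apply: ler_sum => k _.
  by case: ifPn => // _; rewrite mulr0 mulr_ge0// exprn_ge0// ltW.
rewrite -mulr_suml big_mkord.
have -> : (\sum_(k < n.+1) a ^+ k = (a ^+ n.+1 - 1) / (a - 1))%R.
  by rewrite subrX1 mulrAC mulfV ?mul1r// gt_eqF// subr_gt0.
rewrite -(mulr_powRB1 y0 (lt_trans ltr01 s1)) [leRHS]mulrCA mulrC.
rewrite ler_wpM2l// mulrAC ler_wpM2r ?invr_ge0 ?subr_ge0 ?(ltW a1)//.
apply: (@le_trans _ _ (a ^+ n.+1)%R); first by rewrite gerBl.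
rewrite exprS ler_wpM2l ?(ltW a0)// /a -powR_mulrn ?powR_ge0// powRAC.
rewrite powR_mulrn ?ler0n//.
by apply: ge0_ler_powR; rewrite ?nnegrE ?exprn_ge0 ?subr_ge0 ?(ltW s1) ?(ltW ny).
Qed.

(** Dyadic layer cake: if [2 * 2 ^+ k < y <= 4 * 2 ^+ k], the term of index [k]
    alone dominates; heights at most 2 are left to the constant. *)
Lemma dyadic_layers (s : R) (y : \bar R) (E : nat -> bool) : (1 < s)%R -> 0 <= y ->
  (forall k, (2 * 2 ^+ k)%:E < y -> E k) ->
  y `^ s <= (2 `^ s)%:E +
    \sum_(0 <= k <oo) ((4 * 2 ^+ k) `^ s)%:E * ((E k)%:R)%:E.
Proof.
move=> s1 y0 yE; have s0 : (0 < s)%R by exact: lt_trans s1.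
set S := \sum_(0 <= k <oo) _.
have term_ge0 k : 0 <= ((4 * 2 ^+ k) `^ s)%:E * ((E k)%:R)%:E.
  by rewrite mule_ge0// lee_fin powR_ge0.
have S0 : 0 <= S by exact: nneseries_ge0.
have termS k : E k -> ((4 * 2 ^+ k) `^ s)%:E <= S.
  move=> Ek; apply: le_trans (nneseries_lim_ge k.+1 _) => //.
  by rewrite big_nat_recr//= Ek mule1 leeDr// sume_ge0.
have unbounded (r : R) : exists k, (r <= 2 * 2 ^+ k)%R.
  exists (Num.truncn `|r|).+1; apply: (le_trans (ler_norm r)).
  apply: (@le_trans _ _ (Num.truncn `|r|).+1%:R); first exact/ltW/truncnS_gt.
  rewrite -exprS -natrX ler_nat.
  by apply: (leq_trans (ltnW (ltn_expl _ (ltnSn 1)))); rewrite leq_exp2l.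
have mono (x z : R) : (0 <= x)%R -> (x <= z)%R -> (x `^ s <= z `^ s)%R.
  by move=> x0 xz; apply: ge0_ler_powR; rewrite ?nnegrE ?(le_trans x0 xz)// ltW.
case: y y0 yE => [y y0 yE|_ yE|//]; last first.
  suff -> : S = +oo by rewrite addey ?leey.
  apply: eq_infty => r; have [k rk] := unbounded r.
  apply: le_trans (termS k (yE k _)); last by rewrite ltry.
  rewrite lee_fin; apply: (le_trans rk).
  apply: (@le_trans _ _ (4 * 2 ^+ k)%R); first by rewrite ler_wpM2r ?exprn_ge0// ler_nat.
  apply: le1r_powR; rewrite ?(ltW s1)//.
  by rewrite -[leLHS]mulr1 ler_pM// ?ler1n// exprn_ege1// ler1n.
rewrite lee_fin in y0; rewrite poweR_EFin.
have [y2|y2] := leP y 2%R.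
  by rewrite -[leLHS]adde0 leeD// lee_fin mono.
have exP : exists k, (y <= 2 * 2 ^+ k)%R by exact: unbounded.
case: (ex_minnP exP) => -[|k]; first by rewrite expr0 mulr1 leNgt y2.
move=> yk kmin; apply: (@le_trans _ _ S); last by rewrite leeDr// lee_fin powR_ge0.
apply: le_trans (termS k (yE k _)).
  by rewrite lee_fin mono// (le_trans yk)// exprS mulrA -natrM.
by rewrite lte_fin ltNge; apply/negP => /kmin; rewrite ltnn.
Qed.

End geometric.

Section strong_type.
Context (R : realType) (disp : measure_display) (T : measurableType disp).
Variables (nu : {measure set T -> \bar R}) (Q Qs : nat -> set T).
Variables (lev : nat -> nat) (K : R).
Local Open Scope ereal_scope.
Hypothesis mQ : forall j, measurable (Q j).
Hypothesis mQs : forall j, measurable (Qs j).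
Hypothesis Qsub : forall i, Q i `<=` Qs i.
Hypothesis Qmeet : forall i j,
  (lev j <= lev i)%N -> Q i `&` Q j !=set0 -> Q i `<=` Qs j.
Hypothesis K0 : (0 <= K)%R.
Hypothesis nuQs : forall j, nu (Qs j) <= K%:E * nu (Q j).
Hypothesis nuQ : forall j, 0 < nu (Q j) < +oo.

(** Marcinkiewicz interpolation between weak type (1,1) and boundedness: the
    layer at height [2 * 2 ^+ k] is charged to the values of [f] above
    [2 ^+ k], and the resulting geometric sum is bounded by [f `^ s].  The
    additive term, harmless on a space of finite measure, takes care of the
    layers below height 2. *)
Lemma strong_type (s : R) : (1 < s)%R ->
  exists2 C : R, (0 <= C)%R & forall f : T -> \bar R,
    measurable_fun setT f -> (forall x, 0 <= f x) ->
    \int[nu]_x family_maximal nu Q f x `^ s <=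
      (2 `^ s)%:E * nu setT + C%:E * \int[nu]_x f x `^ s.
Proof.
move=> s1; set a := (2 `^ (s - 1))%R.
have a1 : (1 < a)%R by exact: gt1_powR2.
have a0 : (0 < a)%R by exact: lt_trans a1.
have ca : (0 < a / (a - 1))%R by rewrite divr_gt0// subr_gt0.
have K40 : (0 <= 4 `^ s * K)%R by rewrite mulr_ge0// powR_ge0.
exists (4 `^ s * K * (a / (a - 1)))%R; first by rewrite mulr_ge0// ltW.
move=> f mf f0.
(* [E k] contains the points where the maximal function exceeds [2 * 2 ^+ k]. *)
pose S k := [set j | (2 * 2 ^+ k)%:E < average nu (Q j) f].
pose E k := \bigcup_(j in S k) Q j.
have mE k : measurable (E k) by exact: bigcup_measurable.
have mfs : measurable_fun setT (fun x => f x `^ s).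
  exact: (measurableT_comp (measurable_poweR _)).
have E_le k : (2 ^+ k)%:E * nu (E k) <= K%:E * \int[nu]_x truncation (2 ^+ k) f x.
  apply: (weak_type mQ mQs Qsub Qmeet) => //.
  - exact: measurable_truncation.
  - exact: truncation_ge0.
  - by move=> j Sj; apply: truncated_average => //; exact: ltW.
have layer x : family_maximal nu Q f x `^ s <= (2 `^ s)%:E +
    \sum_(0 <= k <oo) ((4 * 2 ^+ k) `^ s)%:E * (\1_(E k) x)%:E.
  apply: (dyadic_layers (E := fun k => x \in E k)) => //.
    exact: family_maximal_ge0.
  move=> k /lt_family_maximal[|j Qj Sj].
    by rewrite lee_fin mulr_ge0// exprn_ge0.
  by rewrite inE; exists j.
have layer_ge0 k x : 0 <= ((4 * 2 ^+ k) `^ s)%:E * (\1_(E k) x)%:E.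
  by rewrite mule_ge0// lee_fin ?powR_ge0.
have mlayer k : measurable_fun setT
    (fun x => ((4 * 2 ^+ k) `^ s)%:E * (\1_(E k) x)%:E).
  by apply: emeasurable_funM => //; exact/measurable_EFinP.
apply: (@le_trans _ _ (\int[nu]_x ((2 `^ s)%:E +
    \sum_(0 <= k <oo) ((4 * 2 ^+ k) `^ s)%:E * (\1_(E k) x)%:E))).
  by apply: le_lower_integral => x _; rewrite ?poweR_ge0.
rewrite ge0_integralD//; last 2 first.
- by move=> x _; exact: nneseries_ge0.
- exact: ge0_emeasurable_sum.
rewrite integral_cst// leeD2l// integral_nneseries//.
apply: (@le_trans _ _ (\sum_(0 <= k <oo) (4 `^ s * K)%:E *
    (\int[nu]_x ((a ^+ k)%:E * truncation (2 ^+ k) f x)))).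
  apply: lee_nneseries => [k _ _|k _]; first exact: integral_ge0.
  rewrite ge0_integralZl//; last exact/measurable_EFinP.
  rewrite integral_indic// setIT ge0_integralZl//; last 3 first.
  - exact: measurable_truncation.
  - by move=> x _; exact: truncation_ge0.
  - by rewrite lee_fin exprn_ge0// ltW.
  rewrite [in leRHS]EFinM -muleA [X in _ <= _ * X]muleCA.
  rewrite (_ : ((4 * 2 ^+ k) `^ s)%R = (4 `^ s * a ^+ k * 2 ^+ k)%R); last first.
    rewrite powRM ?exprn_ge0// -mulrA; congr (_ * _)%R.
    rewrite -(mulr_powRB1 (exprn_ge0 _ _) (lt_trans ltr01 s1))//.
    by rewrite mulrC /a -[in RHS]powR_mulrn ?powR_ge0// powRAC powR_mulrn.
  rewrite !EFinM -!muleA; do 2 (apply: lee_wpmul2l;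
    first by rewrite lee_fin ?powR_ge0// exprn_ge0// ltW).
  exact: E_le.
rewrite nneseriesZl; last first.
  move=> k _; apply: integral_ge0 => x _; rewrite mule_ge0 ?truncation_ge0//.
  by rewrite lee_fin exprn_ge0// ltW.
rewrite -integral_nneseries//; last 2 first.
- by move=> k; apply: emeasurable_funM => //; exact: measurable_truncation.
- move=> k x _; rewrite mule_ge0 ?truncation_ge0//.
  by rewrite lee_fin exprn_ge0// ltW.
rewrite [in leRHS]EFinM -[leRHS]muleA; apply: lee_wpmul2l; rewrite ?lee_fin//.
rewrite -ge0_integralZl//; last 2 first.
- by move=> x _; exact: poweR_ge0.
- by rewrite lee_fin ltW.
apply: le_lower_integral => x _.
  apply: nneseries_ge0 => k _ _; rewrite mule_ge0 ?truncation_ge0//.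
  by rewrite lee_fin exprn_ge0// ltW.
exact: geometric_truncation.
Qed.

End strong_type.

(** * Muckenhoupt's theorem for the maximal function of a family *)

Section roots.
Context (R : realType).

Lemma powR_root (x r : R) : 0 <= x -> 0 < r -> x = (x `^ r) `^ r^-1.
Proof. by move=> x0 r0; rewrite -powRrM mulfV ?gt_eqF// powRr1. Qed.

Lemma poweR_root (x : \bar R) (r : R) : (0 <= x)%E -> 0 < r ->
  x = ((x `^ r) `^ r^-1)%E.
Proof. by move=> x0 r0; rewrite -poweRrM mulfV ?gt_eqF// poweRe1. Qed.

Lemma measurable_inv_ge0 (disp : measure_display) (T : measurableType disp)
    (u : T -> R) :
  measurable_fun setT u -> (forall x, 0 <= u x) ->
  measurable_fun setT (fun x => (u x)^-1).
Proof.
move=> mu u0; rewrite (_ : (fun _ => _) = (fun y => y `^ (-1)) \o u).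
  exact: (measurableT_comp (measurable_powR _)).
by apply/funext => x /=; rewrite powR_inv1.
Qed.

End roots.

Section muckenhoupt_set.
Context (R : realType) (disp : measure_display) (T : measurableType disp).
Variables (mu : {measure set T -> \bar R}) (w sg : T -> R) (q : R).
Hypotheses (mw : measurable_fun setT w) (msg : measurable_fun setT sg).
Hypotheses (w0 : forall x, 0 <= w x) (sg0 : forall x, 0 <= sg x) (q1 : 1 < q).
Hypothesis w_sg : forall x, w x * sg x `^ (q - 1) = 1.

Let W : {measure set T -> \bar R} := density mu mw w0.
Let S : {measure set T -> \bar R} := density mu msg sg0.

(** Pointwise [1 <= u `^ (q - 1) * w + u^-1 * sg]: if the second term is less
    than 1 then [sg < u] and the first term exceeds [sg `^ (q - 1) * w = 1]. *)
Lemma dual_weight_split (B : set T) (u : R) : measurable B -> 0 < u ->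
  (mu B <= (u `^ (q - 1))%:E * W B + (u^-1)%:E * S B)%E.
Proof.
move=> mB u0; have q10 : 0 < q - 1 by rewrite subr_gt0.
have mEw : measurable_fun B (EFin \o w) by apply/measurable_EFinP/measurable_funTS.
have mEs : measurable_fun B (EFin \o sg) by apply/measurable_EFinP/measurable_funTS.
rewrite /W /S /= /density -ge0_integralZl//; last 2 first.
- by move=> x _; rewrite lee_fin.
- by rewrite lee_fin powR_ge0.
rewrite -ge0_integralZl//; last 2 first.
- by move=> x _; rewrite lee_fin.
- by rewrite lee_fin invr_ge0 ltW.
rewrite -ge0_integralD//; last 4 first.
- by move=> x _; rewrite mule_ge0// lee_fin// powR_ge0.
- exact: emeasurable_funM.
- by move=> x _; rewrite mule_ge0// lee_fin// invr_ge0 ltW.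
- exact: emeasurable_funM.
rewrite -[leLHS]mul1e -integral_cst//; apply: le_lower_integral => //= x Bx.
rewrite -!EFinM -EFinD lee_fin.
have [su|us] := leP u (sg x).
  rewrite -[leLHS]add0r lerD ?mulr_ge0 ?powR_ge0//.
  by rewrite mulrC ler_pdivlMr// mul1r.
rewrite -[leLHS]addr0 lerD ?mulr_ge0 ?invr_ge0 ?(ltW u0)//.
rewrite -[leLHS](w_sg x) mulrC ler_wpM2r//.
by apply: ge0_ler_powR; rewrite ?nnegrE ?(ltW q10) ?(ltW u0) ?sg0 ?(ltW us).
Qed.

(** Hoelder's inequality up to the factor [2 `^ q], by optimizing in [u]. *)
Lemma measure_le_dual_weights (B : set T) : measurable B ->
  (0 < mu B < +oo)%E -> (W B < +oo)%E -> (S B < +oo)%E ->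
  [/\ 0 < fine (W B), 0 < fine (S B) &
    fine (mu B) `^ q <= 2 `^ q * (fine (W B) * fine (S B) `^ (q - 1))].
Proof.
move=> mB /andP[mu0 muoo] Woo Soo; have q10 : 0 < q - 1 by rewrite subr_gt0.
have q0 : 0 < q by exact: lt_trans q1.
have [/esym muE /esym WE /esym SE] :
  [/\ (fine (mu B))%:E = mu B, (fine (W B))%:E = W B & (fine (S B))%:E = S B]%E.
  by split; rewrite fineK// ge0_fin_numE.
have m0 : 0 < fine (mu B) by rewrite -lte_fin -muE.
have a0 : 0 <= fine (W B) by rewrite -lee_fin -WE.
have b0 : 0 <= fine (S B) by rewrite -lee_fin -SE.
have split u : 0 < u -> fine (mu B) <= u `^ (q - 1) * fine (W B) + u^-1 * fine (S B).
  move=> u0; have := dual_weight_split mB u0.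
  by rewrite {1}muE {1}WE {1}SE -!EFinM -EFinD lee_fin.
move: (fine (mu B)) (fine (W B)) (fine (S B)) m0 a0 b0 split => m a b m0 a0 b0 split.
have {}b0 : 0 < b.
  rewrite lt_neqAle b0 andbT; apply/eqP => b00.
  (* With [u `^ (q - 1) = v] the first term is less than [m / 2]. *)
  pose v := m / (2 * (a + 1)); have a10 : 0 < a + 1 by rewrite ltr_wpDl.
  have v0 : 0 < v by rewrite divr_gt0// mulr_gt0.
  have := split _ (powR_gt0 ((q - 1)^-1) v0).
  rewrite -powRrM mulVf ?gt_eqF// powRr1 ?(ltW v0)// -b00 mulr0 addr0.
  rewrite /v mulrAC ler_pdivlMr ?mulr_gt0// ler_pM2l// => h.
  have : 2 * (a + 1) <= a + 1 by rewrite (le_trans h)// lerDl.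
  by rewrite ger_pMl// leNgt ltr1n.
(* For [u = 2 * b / m] the second term is [m / 2]. *)
have ub : m / 2 <= (2 * b / m) `^ (q - 1) * a.
  have u0 : 0 < 2 * b / m by rewrite divr_gt0// mulr_gt0.
  have := split _ u0; rewrite (_ : (2 * b / m)^-1 * b = m / 2); last first.
    by field; rewrite ?gt_eqF.
  by rewrite {1}(splitr m) lerD2r.
have ub2 : m `^ q <= 2 `^ q * (a * b `^ (q - 1)).
  rewrite -(mulr_powRB1 (ltW m0) q0) -(mulr_powRB1 (ler0n _ 2) q0).
  move: ub; rewrite powRM ?invr_ge0 ?mulr_ge0 ?(ltW b0) ?(ltW m0)//.
  rewrite powRM ?(ltW b0)// -[m^-1]powR_inv1 ?(ltW m0)// -powRrM mulN1r powRN.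
  rewrite mulrAC ler_pdivlMr ?powR_gt0// mulrAC ler_pdivrMr// => h.
  by apply: (le_trans h); rewrite le_eqVlt; apply/orP; left; apply/eqP; ring.
split => //.
rewrite lt_neqAle a0 andbT; apply/eqP => a00.
by move: ub2; rewrite -a00 mul0r mulr0 leNgt powR_gt0.
Qed.

End muckenhoupt_set.

Section muckenhoupt.
Context (R : realType) (disp : measure_display) (T : measurableType disp).
Variables (mu : {measure set T -> \bar R}) (Q Qs : nat -> set T).
Variables (lev : nat -> nat) (K : R).
Hypothesis mQ : forall j, measurable (Q j).
Hypothesis mQs : forall j, measurable (Qs j).
Hypothesis Qsub : forall i, Q i `<=` Qs i.
Hypothesis Qmeet : forall i j,
  (lev j <= lev i)%N -> Q i `&` Q j !=set0 -> Q i `<=` Qs j.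
Hypothesis K0 : 0 <= K.
Hypothesis muQs : forall j, (mu (Qs j) <= K%:E * mu (Q j))%E.
Hypothesis muQ : forall j, (0 < mu (Q j) < +oo)%E.

Variables (w sg : T -> R) (q A : R).
Hypotheses (mw : measurable_fun setT w) (msg : measurable_fun setT sg).
Hypotheses (w0 : forall x, 0 < w x) (sg0 : forall x, 0 < sg x) (q1 : 1 < q).
Hypothesis w_sg : forall x, w x * sg x `^ (q - 1) = 1.

Let w0' x : 0 <= w x. Proof. exact: ltW. Qed.
Let sg0' x : 0 <= sg x. Proof. exact: ltW. Qed.
Let W : {measure set T -> \bar R} := density mu mw w0'.
Let S : {measure set T -> \bar R} := density mu msg sg0'.

Hypotheses (Woo : (W setT < +oo)%E) (Soo : (S setT < +oo)%E).
Hypothesis A0 : 0 <= A.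
Hypothesis AQ : forall j,
  fine (W (Q j)) * fine (S (Q j)) `^ (q - 1) <= A * fine (mu (Q j)) `^ q.
Hypothesis AQs : forall j,
  fine (W (Qs j)) * fine (S (Qs j)) `^ (q - 1) <= A * fine (mu (Qs j)) `^ q.

Let fin_measure (nu : {measure set T -> \bar R}) B :
  (nu setT < +oo)%E -> measurable B -> (nu B < +oo)%E.
Proof. by move=> nuoo mB; apply: le_lt_trans nuoo; apply: le_measure; rewrite ?inE. Qed.

Let WQoo j : (W (Q j) < +oo)%E. Proof. exact: fin_measure. Qed.
Let SQoo j : (S (Q j) < +oo)%E. Proof. exact: fin_measure. Qed.
Let WQsoo j : (W (Qs j) < +oo)%E. Proof. exact: fin_measure. Qed.
Let SQsoo j : (S (Qs j) < +oo)%E. Proof. exact: fin_measure. Qed.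

Let WSQ j : [/\ 0 < fine (W (Q j)), 0 < fine (S (Q j)) &
  fine (mu (Q j)) `^ q <= 2 `^ q * (fine (W (Q j)) * fine (S (Q j)) `^ (q - 1))].
Proof. exact: (measure_le_dual_weights q1 w_sg (mQ j) (muQ j) (WQoo j) (SQoo j)). Qed.

Let posQ (nu : {measure set T -> \bar R}) j :
  (nu (Q j) < +oo)%E -> 0 < fine (nu (Q j)) -> (0 < nu (Q j) < +oo)%E.
Proof.
move=> oo; rewrite -lte_fin fineK ?oo ?andbT//.
by rewrite ge0_fin_numE.
Qed.

Let WQ j : (0 < W (Q j) < +oo)%E. Proof. by apply: posQ => //; case: (WSQ j). Qed.
Let SQ j : (0 < S (Q j) < +oo)%E. Proof. by apply: posQ => //; case: (WSQ j). Qed.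

Let fine_mono (nu : {measure set T -> \bar R}) j :
  (nu (Qs j) < +oo)%E -> fine (nu (Q j)) <= fine (nu (Qs j)).
Proof.
move=> oo; have h : (nu (Q j) <= nu (Qs j))%E by apply: le_measure; rewrite ?inE.
by apply: fine_le; rewrite ?ge0_fin_numE//; exact: le_lt_trans oo.
Qed.

(** Both weights are doubling along [Q], [Qs]: by the A_q condition the product
    of their powers is comparable to a power of [mu], which is doubling. *)
Let doubling_product j :
  fine (W (Qs j)) * fine (S (Qs j)) `^ (q - 1) <=
  A * (2 * K) `^ q * (fine (W (Q j)) * fine (S (Q j)) `^ (q - 1)).
Proof.
apply: (le_trans (AQs j)); have [_ _ h] := WSQ j.
rewrite -mulrA ler_wpM2l// powRM// mulrAC mulrC.
apply: (le_trans _ (ler_wpM2l (powR_ge0 K q) h)).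
have /andP[mu0 muoo] := muQ j.
have muE : (fine (mu (Q j)))%:E = mu (Q j) by rewrite fineK// ge0_fin_numE.
have Ks : (mu (Qs j) <= (K * fine (mu (Q j)))%:E)%E by rewrite EFinM muE.
have m0 : 0 <= fine (mu (Q j)) by rewrite -lee_fin muE.
rewrite -powRM//; apply: ge0_ler_powR; rewrite ?nnegrE ?mulr_ge0 ?fine_ge0//.
  by rewrite (le_trans ler01)// ltW.
rewrite -lee_fin fineK// ge0_fin_numE//.
by apply: (le_lt_trans Ks); rewrite ltry.
Qed.

Let doubling_W j : (W (Qs j) <= (A * (2 * K) `^ q)%:E * W (Q j))%E.
Proof.
have [a0 b0 _] := WSQ j; have ab := fine_mono (SQsoo j).
have WE : (fine (W (Q j)))%:E = W (Q j) by rewrite fineK// ge0_fin_numE.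
have WsE : (fine (W (Qs j)))%:E = W (Qs j) by rewrite fineK// ge0_fin_numE.
have bs0 := lt_le_trans b0 ab.
rewrite -WE -WsE -EFinM lee_fin -(ler_pM2r (powR_gt0 (q - 1) bs0)).
apply: (le_trans (doubling_product j)); rewrite mulrA ler_wpM2l//.
  by rewrite !mulr_ge0 ?powR_ge0// ltW.
by apply: ge0_ler_powR; rewrite ?nnegrE ?subr_ge0 ?(ltW q1) ?(ltW b0) ?(ltW bs0).
Qed.

Let doubling_S j : (S (Qs j) <= ((A * (2 * K) `^ q) `^ (q - 1)^-1)%:E * S (Q j))%E.
Proof.
have [a0 b0 _] := WSQ j; have ab := fine_mono (WQsoo j).
have SE : (fine (S (Q j)))%:E = S (Q j) by rewrite fineK// ge0_fin_numE.
have SsE : (fine (S (Qs j)))%:E = S (Qs j) by rewrite fineK// ge0_fin_numE.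
have as0 := lt_le_trans a0 ab; have q10 : 0 < q - 1 by rewrite subr_gt0.
have c0 : 0 <= A * (2 * K) `^ q by rewrite mulr_ge0 ?powR_ge0.
have bs0 : 0 <= fine (S (Qs j)) by rewrite fine_ge0.
rewrite -SE -SsE -EFinM lee_fin.
rewrite [leLHS](powR_root bs0 q10) [X in _ * X](powR_root (ltW b0) q10).
rewrite -powRM ?powR_ge0//.
apply: ge0_ler_powR; rewrite ?nnegrE ?invr_ge0 ?mulr_ge0 ?powR_ge0 ?(ltW q10)//.
rewrite -(ler_pM2l as0); apply: (le_trans (doubling_product j)).
by rewrite [leRHS]mulrCA ler_wpM2l// ler_wpM2r ?powR_ge0// fine_mono.
Qed.

Local Open Scope ereal_scope.

(** The density of [g mu] relative to [sg mu]. *)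
Let dualize (g : T -> \bar R) x := g x * ((sg x)^-1)%:E.

Let mdualize g : measurable_fun setT g -> measurable_fun setT (dualize g).
Proof.
move=> mg; apply: emeasurable_funM => //; apply/measurable_EFinP.
exact: measurable_inv_ge0.
Qed.

Let dualize_ge0 g : (forall x, 0 <= g x) -> forall x, 0 <= dualize g x.
Proof. by move=> g0 x; rewrite mule_ge0// lee_fin invr_ge0. Qed.

Let auxiliary (g : T -> \bar R) x :=
  family_maximal S Q (dualize g) x `^ (q - 1) * ((w x)^-1)%:E.

Let mauxiliary g : measurable_fun setT g -> (forall x, 0 <= g x) ->
  measurable_fun setT (auxiliary g).
Proof.
move=> mg g0; apply: emeasurable_funM.
  apply: (measurableT_comp (measurable_poweR _)).
  by apply: measurable_family_maximal.
apply/measurable_EFinP.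
exact: measurable_inv_ge0.
Qed.

Let auxiliary_ge0 g : forall x, 0 <= auxiliary g x.
Proof. by move=> x; rewrite mule_ge0 ?poweR_ge0// lee_fin invr_ge0. Qed.

(** Lerner's pointwise bound.  Let [E] be the average of [dualize g] over a cell,
    relative to [sg mu].  By the A_q condition the power [q - 1] of the average
    of [g] is at most [A * mu (Q j) / W (Q j) * E `^ (q - 1)], and [E] is below
    its maximal function at every point of the cell, so that averaging
    [auxiliary g] over the cell, relative to [w mu], recovers this bound. *)
Let lerner (g : T -> \bar R) x :
  measurable_fun setT g -> (forall x, 0 <= g x) ->
  family_maximal mu Q g x <=
  (A%:E * family_maximal W Q (auxiliary g) x) `^ (q - 1)^-1.
Proof.
move=> mg g0; have q10 : (0 < q - 1)%R by rewrite subr_gt0.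
have hge := auxiliary_ge0 g; have dge := dualize_ge0 g0.
apply: family_maximal_le; first exact: poweR_ge0.
move=> j Qx; have [a0 b0 _] := WSQ j.
have /andP[mu0 muoo] := muQ j.
have muE : (fine (mu (Q j)))%:E = mu (Q j) by rewrite fineK// ge0_fin_numE.
have m0 : (0 < fine (mu (Q j)))%R by rewrite -lte_fin muE.
set m := fine (mu (Q j)) in muE m0; set a := fine (W (Q j)) in a0.
set b := fine (S (Q j)) in b0.
set E := average S (Q j) (dualize g).
have E0 : 0 <= E by exact: average_ge0.
have avgE : average mu (Q j) g = (b / m)%:E * E.
  rewrite /E !averageE// -/m -/b integral_density_set//; last exact: mdualize.
  rewrite muleA -EFinM mulrAC mulfV ?gt_eqF// mul1r; congr (_ * _).
  apply: eq_integral => y _; rewrite /dualize -muleA -EFinM mulVf ?mule1//.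
  by rewrite gt_eqF.
have aux : (m / a)%:E * E `^ (q - 1) <= average W (Q j) (auxiliary g).
  rewrite averageE// -/a mulrC EFinM -muleA; apply: lee_wpmul2l.
    by rewrite lee_fin invr_ge0 ltW.
  rewrite integral_density_set//; last exact: mauxiliary.
  rewrite muE muleC -integral_cst//; apply: le_lower_integral => y Qy; first exact: poweR_ge0.
  rewrite /auxiliary -muleA -EFinM mulVf ?mule1 ?gt_eqF//.
  apply: gt0_ler_poweR; rewrite ?in_itv/= ?leey ?andbT ?(ltW q10)//.
    exact: family_maximal_ge0.
  exact: average_le_family_maximal.
rewrite [leLHS](poweR_root _ q10) ?average_ge0//.
apply: gt0_ler_poweR; rewrite ?in_itv/= ?leey ?andbT ?invr_ge0 ?(ltW q10) ?poweR_ge0//.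
  by rewrite mule_ge0 ?lee_fin ?family_maximal_ge0.
apply: (@le_trans _ _ (A%:E * average W (Q j) (auxiliary g))); last first.
  by apply: lee_wpmul2l; rewrite ?lee_fin//; exact: average_le_family_maximal.
apply: le_trans (lee_wpmul2l _ aux); last by rewrite lee_fin.
have bm0 : (0 <= b / m)%R by rewrite divr_ge0 ?ltW.
rewrite avgE poweRM ?lee_fin// muleA -EFinM; apply: lee_wpmul2r; first exact: poweR_ge0.
rewrite poweR_EFin lee_fin powRM ?invr_ge0 ?(ltW b0) ?(ltW m0)//.
rewrite mulrA ler_pdivlMr// -[m^-1%R]powR_inv1 ?(ltW m0)// -powRrM mulN1r powRN.
rewrite mulrAC ler_pdivrMr ?powR_gt0//.
rewrite -mulrA mulr_powRB1 ?(ltW m0) ?(lt_trans _ q1)// mulrC.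
exact: AQ.
Qed.

(** Both maximal functions of Lerner's bound are relative to the doubling measure
    against which they are integrated: [w mu] with the exponent
    [q' = q / (q - 1)], then [sg mu] with the exponent [q].  The powers of the
    weights match because [w `^ (1 - q') = sg]. *)
Lemma muckenhoupt : exists2 C : R, (0 <= C)%R & forall g : T -> \bar R,
  measurable_fun setT g -> (forall x, 0 <= g x) ->
  \int[mu]_x (family_maximal mu Q g x `^ q * (w x)%:E) <=
  C%:E * (1 + \int[mu]_x (g x `^ q * (w x)%:E)).
Proof.
have q10 : (0 < q - 1)%R by rewrite subr_gt0.
have q0 : (0 < q)%R by exact: lt_trans q1.
pose q' : R := (q / (q - 1))%R.
have q'1 : (1 < q')%R by rewrite /q' ltr_pdivlMr// mul1r gtrBl.
have cW0 : (0 <= A * (2 * K) `^ q)%R by rewrite mulr_ge0 ?powR_ge0.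
have [C1 C10 strongW] := strong_type mQ mQs Qsub Qmeet cW0 doubling_W WQ q'1.
have [C2 C20 strongS] := strong_type mQ mQs Qsub Qmeet (powR_ge0 _ _) doubling_S SQ q1.
have WTE : (fine (W setT))%:E = W setT by rewrite fineK// ge0_fin_numE.
have STE : (fine (S setT))%:E = S setT by rewrite fineK// ge0_fin_numE.
have WT0 : (0 <= fine (W setT))%R by rewrite fine_ge0.
have ST0 : (0 <= fine (S setT))%R by rewrite fine_ge0.
pose c1 : R := (2 `^ q' * fine (W setT))%R.
pose c2 : R := (2 `^ q * fine (S setT))%R.
have c10 : (0 <= c1)%R by rewrite mulr_ge0 ?powR_ge0.
have c20 : (0 <= c2)%R by rewrite mulr_ge0 ?powR_ge0.
exists (A `^ q' * (c1 + C1 * (c2 + C2)))%R.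
  by rewrite mulr_ge0 ?powR_ge0 ?addr_ge0 ?mulr_ge0 ?addr_ge0.
move=> g mg g0; have dge := dualize_ge0 g0; have mdg := mdualize mg.
have maux := mauxiliary mg g0; have hge := auxiliary_ge0 g.
have mpow (nu : {measure set T -> \bar R}) f s : measurable_fun setT f ->
    (forall x, 0 <= f x) ->
    measurable_fun setT (fun x => family_maximal nu Q f x `^ s).
  move=> mf f0; apply: (measurableT_comp (measurable_poweR _)).
  exact: measurable_family_maximal.
have mpow' f s : measurable_fun setT f -> measurable_fun setT (fun x : T => f x `^ s).
  by move=> mf; exact: (measurableT_comp (measurable_poweR _)).
set I := \int[mu]_x (g x `^ q * (w x)%:E).
have I0 : 0 <= I by apply: integral_ge0 => x _; rewrite mule_ge0 ?poweR_ge0// lee_fin.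
have sgE x : (w x `^ (1 - q') = sg x)%R.
  have -> : w x = (sg x `^ (1 - q))%R.
    rewrite -opprB powRN; apply: (mulIf (lt0r_neq0 (powR_gt0 (q - 1) (sg0 x)))).
    by rewrite w_sg mulVf// gt_eqF// powR_gt0.
  rewrite -powRrM (_ : (1 - q) * (1 - q') = 1)%R ?powRr1//.
  by rewrite /q'; field; rewrite gt_eqF.
have dualI : \int[S]_x dualize g x `^ q = I.
  rewrite integral_density//; last 2 first.
  - exact: mpow'.
  - by move=> x; exact: poweR_ge0.
  apply: eq_integral => x _; rewrite /dualize poweRM ?lee_fin ?invr_ge0//.
  rewrite -muleA poweR_EFin -EFinM; congr (_ * _%:E).
  rewrite -[(sg x)^-1%R]powR_inv1// -powRrM mulN1r powRN.
  apply: (mulfI (lt0r_neq0 (powR_gt0 q (sg0 x)))).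
  rewrite mulVKf ?gt_eqF ?powR_gt0// -(mulr_powRB1 (sg0' x) q0).
  by rewrite mulrC mulrCA w_sg mulr1.
have auxI : \int[W]_x auxiliary g x `^ q' =
    \int[S]_x family_maximal S Q (dualize g) x `^ q.
  rewrite integral_density ?integral_density//; last 4 first.
  - exact: mpow.
  - by move=> x; exact: poweR_ge0.
  - exact: mpow'.
  - by move=> x; exact: poweR_ge0.
  apply: eq_integral => x _; rewrite /auxiliary poweRM ?lee_fin ?invr_ge0 ?poweR_ge0//.
  rewrite -poweRrM (_ : (q - 1) * q' = q)%R; last by rewrite mulrC divfK// gt_eqF.
  rewrite -muleA poweR_EFin -EFinM; congr (_ * _%:E).
  rewrite -sgE -[(w x)^-1%R]powR_inv1// -powRrM mulN1r.
  rewrite -{2}[w x]powRr1// -powRD ?(gt_eqF (w0 x)) ?implybT//.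
  by rewrite addrC.
have aux_le : \int[W]_x auxiliary g x `^ q' <= c2%:E + C2%:E * I.
  by rewrite auxI -dualI /c2 EFinM STE; exact: strongS.
rewrite -(integral_density mu mw w0')//; last 2 first.
- exact: mpow.
- by move=> x; exact: poweR_ge0.
apply: (@le_trans _ _ (\int[W]_x ((A `^ q')%:E *
    family_maximal W Q (auxiliary g) x `^ q'))).
  apply: le_lower_integral => x _; first exact: poweR_ge0.
  rewrite -poweR_EFin -poweRM ?lee_fin ?family_maximal_ge0// /q' mulrC poweRrM.
  apply: gt0_ler_poweR; rewrite ?in_itv/= ?leey ?andbT ?poweR_ge0 ?family_maximal_ge0 ?(ltW q0)//.
  exact: lerner.
rewrite ge0_integralZl//; last 3 first.
- exact: mpow.
- by move=> x _; exact: poweR_ge0.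
- by rewrite lee_fin powR_ge0.
rewrite [in leRHS]EFinM -[leRHS]muleA; apply: lee_wpmul2l; first by rewrite lee_fin powR_ge0.
apply: (le_trans (strongW _ maux hge)); rewrite -WTE -EFinM -/c1.
apply: (@le_trans _ _ (c1%:E + C1%:E * (c2%:E + C2%:E * I))).
  by rewrite leeD2l//; apply: lee_wpmul2l; rewrite ?lee_fin.
have -> : (c1 + C1 * (c2 + C2))%:E = c1%:E + C1%:E * (c2%:E + C2%:E) by [].
rewrite ge0_muleDl//; last by rewrite mule_ge0 ?adde_ge0 ?lee_fin.
apply: leeD; first by rewrite lee_pemulr ?lee_fin// leeDl.
rewrite -muleA; apply: lee_wpmul2l; rewrite ?lee_fin//.
rewrite ge0_muleDl ?lee_fin//; apply: leeD; first by rewrite lee_pemulr ?lee_fin// leeDl.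
by apply: lee_wpmul2l; rewrite ?lee_fin// leeDr.
Qed.

End muckenhoupt.

(** * A countable family of balls *)

Section ball_family.
Context (R : realType) (disp : measure_display) (X : measurableType disp).
Variables (d : X -> X -> R) (mu : {measure set X -> \bar R}).
Variables (c0 C D : R).
Hypothesis d_ge0 : forall x y, 0 <= d x y.
Hypothesis d_eq0 : forall x y, d x y = 0 -> x = y.
Hypothesis d_sym : forall x y, d x y = d y x.
Hypothesis c01 : 1 <= c0.
Hypothesis d_tri : forall x y z, d x y <= c0 * (d x z + d z y).
Hypothesis mball : forall x r, measurable (qball d x r).
Hypothesis muball : forall x r, 0 < r -> (0 < mu (qball d x r) < +oo)%E.
Hypothesis C1 : 1 <= C.
Hypothesis doubling : forall x r, 0 < r ->
  (mu (qball d x (2 * r)) <= C%:E * mu (qball d x r))%E.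
Hypothesis D0 : 0 < D.
Hypothesis dD : forall x y, d x y < D.

Let c00 : 0 < c0. Proof. exact: lt_le_trans c01. Qed.

Lemma qball_subset x r s : r <= s -> qball d x r `<=` qball d x s.
Proof. by move=> rs y; rewrite /qball /= => /lt_le_trans; exact. Qed.

Lemma le_mu (A B : set X) : measurable A -> measurable B -> A `<=` B ->
  (mu A <= mu B)%E.
Proof. by move=> mA mB AB; apply: le_measure; rewrite ?inE. Qed.

Lemma doubling_iter n x r : 0 < r ->
  (mu (qball d x (2 ^+ n * r)) <= (C ^+ n)%:E * mu (qball d x r))%E.
Proof.
move=> r0; elim: n => [|n IHn]; first by rewrite !expr0 mul1r mul1e.
rewrite exprS -mulrA; apply: (le_trans (doubling _ _)).
  by rewrite mulr_gt0// exprn_gt0.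
rewrite exprS EFinM -muleA; apply: lee_wpmul2l => //.
by rewrite lee_fin (le_trans _ C1).
Qed.

Lemma doubling_le n x r s : 0 < r -> s <= 2 ^+ n * r ->
  (mu (qball d x s) <= (C ^+ n)%:E * mu (qball d x r))%E.
Proof.
move=> r0 sr; apply: le_trans (doubling_iter n x r0).
by apply: le_mu => //; exact: qball_subset.
Qed.

Lemma exists_exp2 (r : R) : exists n, r <= 2 ^+ n.
Proof.
exists (Num.truncn `|r|).+1; apply: (le_trans (ler_norm r)).
apply: (@le_trans _ _ (Num.truncn `|r|).+1%:R); first exact/ltW/truncnS_gt.
by rewrite -natrX ler_nat ltnW// ltn_expl.
Qed.

Lemma qball_setT x r : D <= r -> qball d x r = setT.
Proof.
by move=> Dr; apply/seteqP; split => // y _; rewrite /qball/= (lt_le_trans (dD _ _)).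
Qed.

(** Total boundedness: the balls of radius [r / (2 * c0)] around an
    [r]-separated family are disjoint, and doubling bounds their measures from
    below by a fixed proportion of the measure of the space. *)
Lemma finite_net (x0 : X) (r : R) : 0 < r ->
  exists f : nat -> X, forall x, exists i, d (f i) x < r.
Proof.
move=> r0; apply: contrapT => nonet.
have far (f : nat -> X) : exists x, forall i, r <= d (f i) x.
  apply: contrapT => h; apply: nonet; exists f => x; apply: contrapT => hx.
  apply: h; exists x => i; rewrite leNgt; apply/negP => dr; apply: hx.
  by exists i.
have sep n : exists f : nat -> X, forall i j, (i < j < n)%N -> r <= d (f i) (f j).
  elim: n => [|n [f hf]]; first by exists (fun=> x0) => i j; rewrite ltn0 andbF.
  have [x hx] := far (fun i => if (i < n)%N then f i else x0).
  exists (fun i => if (i < n)%N then f i else x) => i j /andP[ij].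
  rewrite ltnS leq_eqVlt => /predU1P[jn|jn].
    by rewrite jn ltnn; have := hx i; rewrite -jn ij.
  by rewrite jn (ltn_trans ij jn); apply: hf; rewrite ij.
pose e := r / (2 * c0); have e0 : 0 < e by rewrite divr_gt0// mulr_gt0.
have [m hm] := exists_exp2 (D / e).
have big x : (mu setT <= (C ^+ m)%:E * mu (qball d x e))%E.
  rewrite -(qball_setT x (lexx D)); apply: doubling_le => //.
  by rewrite -ler_pdivrMr.
have /andP[T0 Too] := muball x0 D0; rewrite (qball_setT x0 (lexx D)) in T0 Too.
have TE : (fine (mu setT))%:E = mu setT by rewrite fineK// ge0_fin_numE.
have t0 : 0 < fine (mu setT) by rewrite -lte_fin TE.
have Cm0 : 0 < C ^+ m by rewrite exprn_gt0// (lt_le_trans _ C1).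
have low x : ((fine (mu setT) / C ^+ m)%:E <= mu (qball d x e))%E.
  by rewrite mulrC EFinM TE lee_pdivrMl.
have count n : (n%:R <= C ^+ m).
  have [f hf] := sep n.
  have dis i j x : (i < j < n)%N -> qball d (f i) e x -> qball d (f j) e x -> False.
    move=> ijn ix jx; have := hf i j ijn; rewrite leNgt => /negP; apply.
    apply: (le_lt_trans (d_tri _ _ x)).
    have -> : r = c0 * (e + e) by rewrite /e; field; rewrite gt_eqF.
    by rewrite ltr_pM2l// ltrD// d_sym.
  pose F i := qball d (f i) e.
  have Un k : (k <= n)%N ->
      ((k%:R * (fine (mu setT) / C ^+ m))%:E <=
       mu (\big[setU/set0]_(i < k) F i))%E.
    elim: k => [|k IHk] kn; first by rewrite mul0r.
    rewrite big_ord_recr /= measureU; last 3 first.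
    - by apply: bigsetU_measurable => i _; exact: mball.
    - exact: mball.
    - rewrite -(bigcup_mkord k F); apply/seteqP; split => // x [[i /= ik ix] kx].
      by apply: (dis i k x) => //; rewrite ik.
    rewrite -natr1 mulrDl mul1r EFinD leeD//; [exact: IHk (ltnW kn)|exact: low].
  have := le_trans (Un n (leqnn n)) (le_mu _ _ (@subsetT _ _)).
  rewrite -TE lee_fin mulrCA ger_pMr// ler_pdivrMr// mul1r; apply => //.
  by apply: bigsetU_measurable => i _; exact: mball.
have := count (Num.truncn (C ^+ m)).+1.
by rewrite leNgt truncnS_gt.
Qed.

Definition scale (k : nat) : R := D / 2 ^+ k.

Lemma scale_gt0 k : 0 < scale k.
Proof. by rewrite divr_gt0// exprn_gt0. Qed.

Lemma scale_le k l : (k <= l)%N -> scale l <= scale k.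
Proof.
move=> kl; rewrite ler_pM2l// lef_pV2 ?posrE ?exprn_gt0//.
by rewrite ler_weXn2l// ler1n.
Qed.

Lemma exists_centers (x0 : X) : exists (c : nat -> X) (lev : nat -> nat),
  forall k x, exists2 j, lev j = k & d (c j) x < scale k.
Proof.
have /choice[f hf] k := finite_net x0 (scale_gt0 k).
pose ki j : nat * nat := odflt (0, 0)%N (unpickle j).
exists (fun j => f (ki j).1 (ki j).2), (fun j => (ki j).1) => k x.
have [i hi] := hf k x; exists (pickle (k, i)); by rewrite /ki pickleK.
Qed.

Variables (c : nat -> X) (lev : nat -> nat).
Hypothesis centers : forall k x, exists2 j, lev j = k & d (c j) x < scale k.

(** The radii leave room for the quasi-triangle inequality: a ball of radius
    [scale k] around a point at distance less than [scale k] of the center lies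
    in the cell, and a cell meeting another one of a coarser level lies in the
    enlargement of the latter. *)
Definition cell j := qball d (c j) (2 * c0 * scale (lev j)).
Definition enlarged_cell j := qball d (c j) (6 * c0 ^+ 3 * scale (lev j)).

Let cell_radius_gt0 j : 0 < 2 * c0 * scale (lev j).
Proof. by rewrite !mulr_gt0// scale_gt0. Qed.

Let c02 : 1 <= c0 ^+ 2. Proof. by rewrite exprn_ege1. Qed.

Lemma cell_sub_enlarged j : cell j `<=` enlarged_cell j.
Proof.
apply: qball_subset; rewrite ler_wpM2r ?(ltW (scale_gt0 _))//.
rewrite exprS mulrCA [2 * c0]mulrC ler_wpM2l ?(ltW c00)//.
by have := c02; lra.
Qed.

Lemma cell_meet i j : (lev j <= lev i)%N -> cell i `&` cell j !=set0 ->
  cell i `<=` enlarged_cell j.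
Proof.
move=> ji [z [iz jz]] y iy; rewrite /enlarged_cell /qball /=.
have si := scale_le ji.
apply: (le_lt_trans (d_tri _ _ z)).
apply: (@lt_le_trans _ _ (c0 * (2 * c0 * scale (lev j) + c0 * (4 * c0 * scale (lev j))))).
  rewrite ltr_pM2l// ltr_leD// (le_trans (d_tri _ _ (c i)))// ler_pM2l//.
  have -> : 4 * c0 * scale (lev j) = 2 * c0 * scale (lev j) + 2 * c0 * scale (lev j).
    by rewrite -mulrDl -mulrDl; congr (_ * _ * _); lra.
  have le2 : 2 * c0 * scale (lev i) <= 2 * c0 * scale (lev j).
    by rewrite ler_wpM2l// mulr_ge0// ltW.
  by rewrite lerD// ltW// (lt_le_trans _ le2)// d_sym.
have -> : c0 * (2 * c0 * scale (lev j) + c0 * (4 * c0 * scale (lev j))) =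
  (2 * c0 ^+ 2 + 4 * c0 ^+ 3) * scale (lev j) by ring.
rewrite ler_wpM2r ?(ltW (scale_gt0 _))//.
have -> : 6 * c0 ^+ 3 = 2 * (c0 * c0 ^+ 2) + 4 * c0 ^+ 3 :> R by rewrite -exprS; ring.
by rewrite lerD2r ler_wpM2l// ler_peMl// (le_trans ler01).
Qed.

Lemma mu_enlarged_cell : exists2 K : R, 0 <= K &
  forall j, (mu (enlarged_cell j) <= K%:E * mu (cell j))%E.
Proof.
have [m hm] := exists_exp2 (3 * c0 ^+ 2).
exists (C ^+ m); first by rewrite exprn_ge0// (le_trans _ C1).
move=> j; apply: doubling_le => //; rewrite [leRHS]mulrA ler_wpM2r ?(ltW (scale_gt0 _))//.
have -> : 6 * c0 ^+ 3 = 3 * c0 ^+ 2 * (2 * c0) by ring.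
by rewrite ler_wpM2r// mulr_ge0// ltW.
Qed.

(** Every ball lies in a cell of comparable measure: the cell is taken at the
    scale of the radius, with a center close to the center of the ball. *)
Lemma ball_in_cell : exists2 K : R, 0 < K & forall x r, 0 < r ->
  exists j, [/\ cell j x, qball d x r `<=` cell j &
    (mu (cell j) <= K%:E * mu (qball d x r))%E].
Proof.
have [m hm] := exists_exp2 (6 * c0 ^+ 2).
exists (C ^+ m); first by rewrite exprn_gt0// (lt_le_trans _ C1).
move=> x r r0; have [rD|Dr] := leP r D; last first.
  have [j jl jx] := centers 0 x.
  have jT : cell j = setT.
    rewrite /cell jl qball_setT// /scale expr0 divr1 -[leLHS]mul1r.
    by rewrite ler_wpM2r ?(ltW D0)//; have := c01; lra.
  exists j; rewrite jT; split => //.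
  rewrite (qball_setT x (ltW Dr)) -[leLHS]mul1e; apply: lee_wpmul2r => //.
  by rewrite lee_fin exprn_ege1.
have exP : exists k, scale k < r.
  have [k hk] := exists_exp2 (D / r); exists k.+1.
  rewrite /scale ltr_pdivrMr ?exprn_gt0// -ltr_pdivrMl// mulrC.
  by rewrite (le_lt_trans hk)// ltr_eXn2l// ltr1n.
case: (ex_minnP exP) => -[|k] hk kmin.
  by move: hk; rewrite /scale expr0 divr1 ltNge rD.
have rk : r <= scale k by rewrite leNgt; apply/negP => /kmin; rewrite ltnn.
have kr : scale k < 2 * r.
  rewrite (_ : scale k = 2 * scale k.+1); first by rewrite ltr_pM2l.
  by rewrite /scale exprS; field; rewrite expf_neq0.
have [j jk jx] := centers k x; exists j.
have sk0 := scale_gt0 k.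
split.
- rewrite /cell /qball/= jk (lt_le_trans jx)// ler_peMl ?(ltW sk0)//.
  by have := c01; lra.
- move=> y; rewrite /cell /qball/= jk => xy.
  apply: (le_lt_trans (d_tri _ _ x)).
  rewrite [2 * c0]mulrC -mulrA ltr_pM2l// mulr_natl mulr2n ltrD//.
  exact: lt_le_trans rk.
- apply: (@le_trans _ _ (mu (qball d x (6 * c0 ^+ 2 * r)))); last first.
    by apply: doubling_le => //; rewrite ler_wpM2r// ltW.
  apply: le_mu => [||y]; [exact: mball|exact: mball|].
  rewrite /cell /qball/= jk => jy.
  apply: (le_lt_trans (d_tri _ _ (c j))).
  apply: (@lt_le_trans _ _ (c0 * (scale k + 2 * c0 * scale k))).
    by rewrite ltr_pM2l// ltrD// d_sym.
  apply: (@le_trans _ _ (3 * c0 ^+ 2 * scale k)).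
    have -> : c0 * (scale k + 2 * c0 * scale k) = (c0 + 2 * c0 ^+ 2) * scale k by ring.
    rewrite ler_wpM2r ?(ltW sk0)//.
    have -> : 3 * c0 ^+ 2 = c0 * c0 + 2 * c0 ^+ 2 by ring.
    by rewrite lerD2r ler_peMl// ltW.
  have -> : 6 * c0 ^+ 2 * r = 3 * c0 ^+ 2 * (2 * r) by ring.
  by rewrite ler_wpM2l ?(ltW kr)// mulr_ge0// (le_trans ler01).
Qed.

Lemma mu_cell_lower j : (mu setT <= (C ^+ lev j)%:E * mu (cell j))%E.
Proof.
rewrite -(qball_setT (c j) (lexx D)); apply: doubling_le => //.
apply: (@le_trans _ _ (2 ^+ lev j * scale (lev j))).
  by rewrite /scale mulrCA mulfV ?mulr1// gt_eqF// exprn_gt0.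
rewrite ler_wpM2l ?exprn_ge0// ler_peMl ?(ltW (scale_gt0 _))//.
by have := c01; lra.
Qed.

(** A cell of level [k] has a diameter of order [2 ^- k], whose logarithm is
    proportional to [k].  The condition only concerns distances up to [1 / 2];
    the finitely many levels below [2 * n + 2] are covered by the bound [P]. *)
Lemma cell_oscillation (p : X -> R) (A P : R) : 0 < A ->
  (forall x y, `|p x - p y| <= P) ->
  (forall x y, 0 < d x y <= 1 / 2 -> `|p x - p y| <= A / ln (1 / d x y)) ->
  exists2 H : R, 0 <= H &
    forall j x y, cell j x -> cell j y -> `|p x - p y| * (lev j)%:R <= H.
Proof.
move=> A0 pP plog; have [n hn] := exists_exp2 (4 * c0 ^+ 2 * D).
have ln20 : 0 < ln (2 : R) by rewrite ln_gt0// ltr1n.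
have cA : 0 <= 2 * A / ln 2 :> R by rewrite divr_ge0 ?mulr_ge0 ?ltW.
exists (`|P| * (2 * n).+1%:R + 2 * A / ln 2).
  by rewrite addr_ge0// mulr_ge0.
move=> j x y jx jy; set k := lev j.
have [kn|kn] := leqP k (2 * n).+1.
  apply: (@le_trans _ _ (`|P| * (2 * n).+1%:R)).
    by rewrite ler_pM// ?ler_nat// (le_trans (pP x y))// ler_norm.
  by rewrite lerDl.
apply: (@le_trans _ _ (2 * A / ln 2)); last by rewrite lerDr mulr_ge0.
have [->|/eqP xy] := pselect (x = y).
  by rewrite subrr normr0 mul0r.
have dxy0 : 0 < d x y.
  by rewrite lt_neqAle d_ge0 andbT; apply/negP => /eqP/esym/d_eq0/eqP; exact/negP.
have nk : (n <= k)%N by apply: leq_trans (ltnW kn); rewrite -addn1 mul2n -addnn -addnA leq_addr.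
have dk : d x y <= (2 ^+ (k - n))^-1.
  apply: (@le_trans _ _ (4 * c0 ^+ 2 * D / 2 ^+ k)).
    have -> : 4 * c0 ^+ 2 * D / 2 ^+ k = c0 * (2 * c0 * scale k + 2 * c0 * scale k).
      by rewrite /scale; ring.
    by apply/ltW/(le_lt_trans (d_tri _ _ (c j))); rewrite ltr_pM2l// ltrD// d_sym.
  have -> : (2 ^+ (k - n))^-1 = 2 ^+ n / 2 ^+ k :> R.
    by rewrite -[in RHS](subnK nk) exprD invfM mulrCA mulfV ?mulr1// expf_neq0.
  by rewrite ler_wpM2r// invr_ge0 exprn_ge0.
have kn2 : (0 < k - n)%N.
  by rewrite subn_gt0 (leq_trans _ kn)// ltnS mul2n -addnn -addnS leq_addr.
have d2 : d x y <= 1 / 2.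
  rewrite (le_trans dk)// div1r lef_pV2 ?posrE ?exprn_gt0//.
  by rewrite -[leLHS]expr1 ler_weXn2l// ler1n.
have lnk : (k%:R / 2) * ln 2 <= ln (1 / d x y).
  apply: (@le_trans _ _ ((k - n)%:R * ln 2)).
    rewrite ler_wpM2r ?(ltW ln20)// ler_pdivrMr// -natrM ler_nat.
    by rewrite mulnBl leq_subRL ?leq_mul2r ?nk ?orbT// !muln2 -[k.*2]addnn leq_add2r -mul2n (ltnW (ltnW kn)).
  rewrite mulr_natl -lnXn// ler_ln ?posrE ?exprn_gt0 ?divr_gt0//.
  by rewrite div1r -[leLHS]invrK lef_pV2// posrE invr_gt0 exprn_gt0.
have k0 : 0 < k%:R / 2 * ln 2 :> R by rewrite !mulr_gt0// ltr0n (leq_trans _ kn).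
apply: (@le_trans _ _ (A / (k%:R / 2 * ln 2) * k%:R)); last first.
  rewrite le_eqVlt; apply/orP; left; apply/eqP; field.
  by rewrite pnatr_eq0 gt_eqF//= -lt0n (leq_trans _ kn).
rewrite ler_wpM2r//; apply: (le_trans (plog x y _)); first by rewrite dxy0.
by rewrite ler_pM2l// lef_pV2 ?posrE// (lt_le_trans k0).
Qed.

End ball_family.

(** * Variable exponents *)

Section measurable_powR2.
Context (R : realType) (disp : measure_display) (T : measurableType disp).

Lemma measurable_powR2 (f g : T -> R) :
  measurable_fun setT f -> measurable_fun setT g ->
  measurable_fun setT (fun x => f x `^ g x).
Proof.
move=> mf mg; rewrite /powR; apply: measurable_fun_ifT.
- exact: measurable_fun_eqr.
- rewrite (_ : (fun _ => _) = (fun b : bool => b%:R) \o (fun x => g x == 0)) //.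
  by apply: measurableT_comp => //; exact: measurable_fun_eqr.
- by apply: measurableT_comp => //; apply: measurable_funM => //; apply: measurableT_comp.
Qed.

End measurable_powR2.

Section variable_exponent.
Context (R : realType) (disp : measure_display) (T : measurableType disp).
Variables (mu : {measure set T -> \bar R}) (Q : nat -> set T) (lev : nat -> nat).
Variables (w sg p : T -> R) (q P M H : R).
Hypothesis mQ : forall j, measurable (Q j).
Hypothesis muQ : forall j, (0 < mu (Q j) < +oo)%E.
Hypothesis muT : (0 < mu setT < +oo)%E.
Hypotheses (mw : measurable_fun setT w) (msg : measurable_fun setT sg).
Hypothesis mp : measurable_fun setT p.
Hypotheses (w0 : forall x, 0 < w x) (sg0 : forall x, 0 < sg x) (q1 : 1 < q).
Hypothesis w_sg : forall x, w x * sg x `^ (q - 1) = 1.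
Hypothesis pq : forall x, q <= p x <= P.
Hypothesis M1 : 1 <= M.
Hypothesis mu_lower : forall j, (mu setT <= (M ^+ lev j)%:E * mu (Q j))%E.
Hypothesis osc : forall j x y, Q j x -> Q j y -> `|p x - p y| * (lev j)%:R <= H.
Hypothesis Soo : (\int[mu]_x (sg x)%:E < +oo)%E.

Let q0 : 0 < q. Proof. exact: lt_trans q1. Qed.
Let q10 : 0 < q - 1. Proof. by rewrite subr_gt0. Qed.
Let p0 x : 0 < p x. Proof. by have /andP[h _] := pq x; exact: lt_le_trans h. Qed.
Let pq1 x : 1 <= p x / q.
Proof. by have /andP[h _] := pq x; rewrite ler_pdivlMr// mul1r. Qed.
Let pP x : p x / q <= P.
Proof.
have /andP[h1 h] := pq x; rewrite ler_pdivrMr//; apply: (le_trans h).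
by rewrite ler_peMr ?(ltW q1)// (le_trans (ltW q0))// (le_trans h1).
Qed.

Let pow (g : T -> R) x := g x `^ (p x / q).

Let mpow (g : T -> R) : measurable_fun setT g -> measurable_fun setT (pow g).
Proof.
move=> mg; apply: measurable_powR2 => //.
by apply: measurable_funM.
Qed.

Let powq g x : pow g x `^ q = g x `^ p x.
Proof. by rewrite /pow -powRrM divfK// gt_eqF. Qed.

(** If [sg x < b] then [1 = w x * sg x `^ (q - 1) <= w x * b `^ (q - 1)]. *)
Let dual_bound x (b : R) : 0 <= b -> b <= b `^ q * w x + sg x.
Proof.
move=> b0; have [bs|sb] := leP b (sg x).
  by rewrite (le_trans bs)// lerDr mulr_ge0 ?powR_ge0// ltW.
rewrite -[leLHS]addr0 lerD ?(ltW (sg0 x))//.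
rewrite -(mulr_powRB1 b0 q0) -mulrA ler_peMr// -[leLHS](w_sg x) mulrC.
rewrite ler_wpM2r ?(ltW (w0 x))//.
by apply: ge0_ler_powR; rewrite ?nnegrE ?(ltW q10) ?(ltW (sg0 x)) ?(ltW sb).
Qed.

Local Open Scope ereal_scope.

Let mutE : (fine (mu setT))%:E = mu setT.
Proof. by have /andP[h k] := muT; rewrite fineK// ge0_fin_numE. Qed.

Let mut0 : (0 < fine (mu setT))%R.
Proof. by rewrite -lte_fin mutE; have /andP[] := muT. Qed.

Let SE : (fine (\int[mu]_x (sg x)%:E))%:E = \int[mu]_x (sg x)%:E.
Proof. by rewrite fineK// ge0_fin_numE// integral_ge0// => x _; rewrite lee_fin ltW. Qed.

(** With [S] the integral of [sg], the average of [1 + pow g] over a cell is at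
    most [1 + (1 + S) / mu (Q j)], and [L - 1 = 1 + (1 + S) / mu setT]. *)
Let L : R := (2 + (fine (\int[mu]_x (sg x)%:E)) / fine (mu setT) + 1 / fine (mu setT))%R.

Let S0 : (0 <= fine (\int[mu]_x (sg x)%:E))%R.
Proof. by apply: fine_ge0; apply: integral_ge0 => x _; rewrite lee_fin ltW. Qed.

Let L1 : (1 <= L)%R.
Proof.
have h1 := divr_ge0 S0 (ltW mut0); have h2 := divr_ge0 ler01 (ltW mut0).
by rewrite /L; lra.
Qed.

Let pow_integral (g : T -> R) : measurable_fun setT g -> (forall x, (0 <= g x)%R) ->
  \int[mu]_x (g x `^ p x * w x)%:E <= 1 ->
  \int[mu]_x (pow g x)%:E <= (1 + fine (\int[mu]_x (sg x)%:E))%:E.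
Proof.
move=> mg g0 g1.
apply: (@le_trans _ _ (\int[mu]_x ((g x `^ p x * w x)%:E + (sg x)%:E))).
  apply: le_lower_integral => x _; rewrite ?lee_fin ?powR_ge0//.
  by rewrite -powq; apply: dual_bound; exact: powR_ge0.
rewrite ge0_integralD//; last 4 first.
- by move=> x _; rewrite lee_fin mulr_ge0 ?powR_ge0 ?ltW.
- by apply/measurable_EFinP; apply: measurable_funM => //; exact: measurable_powR2.
- by move=> x _; rewrite lee_fin ltW.
- exact/measurable_EFinP.
by rewrite EFinD SE leeD2r.
Qed.

(** [g <= 1 + pow g], the integral of [pow g] is bounded by [pow_integral], and
    the measure of a cell decreases at most geometrically with its level. *)
Let crude_average (g : T -> R) j : measurable_fun setT g -> (forall x, (0 <= g x)%R) ->
  \int[mu]_x (g x `^ p x * w x)%:E <= 1 ->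
  average mu (Q j) (EFin \o g) <= (L * M ^+ lev j)%:E.
Proof.
move=> mg g0 g1; have /andP[m0 moo] := muQ j.
have mE : (fine (mu (Q j)))%:E = mu (Q j) by rewrite fineK// ge0_fin_numE.
set m := fine _ in mE.
have {}m0 : (0 < m)%R by rewrite -lte_fin mE.
have Ml : (1 <= M ^+ lev j)%R by exact: exprn_ege1.
rewrite averageE// -/m.
have : \int[mu]_(x in Q j) (g x)%:E <=
    (m + (1 + fine (\int[mu]_x (sg x)%:E)))%:E.
  apply: (@le_trans _ _ (\int[mu]_(x in Q j) (1 + (pow g x)%:E))).
    apply: le_lower_integral => x _; rewrite ?lee_fin// /pow.
    have [gx|gx] := leP (g x) 1%R; first by rewrite (le_trans gx)// lerDl powR_ge0.
    by rewrite (le_trans (le1r_powR (ltW gx) (pq1 x)))// lerDr.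
  rewrite ge0_integralD//; last 2 first.
  - by move=> x _; rewrite lee_fin powR_ge0.
  - by apply/measurable_EFinP/measurable_funTS; exact: mpow.
  rewrite integral_cst// mul1e -mE EFinD leeD2l//.
  apply: le_trans (pow_integral mg g0 g1).
  by apply: le_lower_integral_set => // x; rewrite lee_fin powR_ge0.
have mi0 : 0 <= (m^-1)%:E by rewrite lee_fin invr_ge0 ltW.
move=> /(lee_wpmul2l mi0) /le_trans; apply.
rewrite -EFinM lee_fin mulrDr mulVf ?gt_eqF//.
have mM : (m^-1 <= M ^+ lev j / fine (mu setT))%R.
  rewrite ler_pdivlMr// mulrC ler_pdivrMr//.
  by rewrite -lee_fin EFinM mE mutE; exact: mu_lower.
apply: (@le_trans _ _ (M ^+ lev j + M ^+ lev j / fine (mu setT) *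
    (1 + fine (\int[mu]_x (sg x)%:E))))%R.
  by rewrite lerD// ler_wpM2r// addr_ge0.
have -> : (M ^+ lev j + M ^+ lev j / fine (mu setT) *
    (1 + fine (\int[mu]_x (sg x)%:E)))%R = ((L - 1) * M ^+ lev j)%R.
  by rewrite /L; field; rewrite gt_eqF.
by rewrite ler_wpM2r ?(le_trans ler01)// gerBl.
Qed.

Let const : R := (L `^ P * M `^ H)%R.

(** Where the logarithmic condition is used: a number at most polynomial in the
    inverse of the scale stays bounded when raised to the oscillation of the
    exponent, by [M `^ (lev j * osc) <= M `^ H]. *)
Let oscillation_power j x y (u : R) : Q j x -> Q j y ->
  (1 <= u)%R -> (u <= L * M ^+ lev j)%R ->
  (u `^ ((p x - p y) / q) <= const)%R.
Proof.
move=> jx jy u1 uL.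
have oq : ((p x - p y) / q <= `|p x - p y|)%R.
  rewrite ler_pdivrMr// (le_trans (ler_norm _))//.
  by rewrite ler_peMr// ltW.
have u0 : (0 <= u)%R by rewrite (le_trans ler01).
have L0 : (0 <= L)%R by rewrite (le_trans ler01).
have M0 : (0 <= M)%R by rewrite (le_trans ler01).
have opP : (`|p x - p y| <= P)%R.
  have /andP[a b] := pq x; have /andP[a' b'] := pq y.
  by rewrite ler_norml; apply/andP; split; have := q0; lra.
apply: (le_trans (ler_powR u1 oq)).
apply: (@le_trans _ _ ((L * M ^+ lev j) `^ `|p x - p y|)%R).
  by apply: ge0_ler_powR; rewrite ?nnegrE ?mulr_ge0 ?exprn_ge0.
rewrite powRM ?exprn_ge0// /const ler_pM ?powR_ge0//.
  exact: ler_powR.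
rewrite -powR_mulrn// -powRrM mulrC; apply: ler_powR => //.
exact: osc.
Qed.

Let const0 : (0 <= const)%R. Proof. by rewrite mulr_ge0 ?powR_ge0. Qed.

(** Instead of Jensen's inequality with the least exponent over the cell, only
    the values of [g] above the half [u] of its average are kept: there
    [g = pow g * g `^ (1 - p y / q) <= pow g * u `^ (1 - p y / q)], and if
    [1 < u] the exponent [p y] can be changed to [p x] at a bounded cost. *)
Lemma average_pow_le j x (g : T -> R) : measurable_fun setT g -> (forall x, (0 <= g x)%R) ->
  \int[mu]_x (g x `^ p x * w x)%:E <= 1 -> Q j x ->
  average mu (Q j) (EFin \o g) `^ (p x / q) <=
  (2 `^ P * (1 + const))%:E * (1 + average mu (Q j) (fun y => (pow g y)%:E)).
Proof.
move=> mg g0 g1 jx.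
have aL := crude_average j mg g0 g1.
have a0 : 0 <= average mu (Q j) (EFin \o g) by apply: average_ge0 => y; rewrite lee_fin.
have powg0 y : 0 <= (pow g y)%:E by rewrite lee_fin powR_ge0.
have G0 : 0 <= average mu (Q j) (fun y => (pow g y)%:E) by exact: average_ge0.
have /andP[m0 moo] := muQ j.
have mE : (fine (mu (Q j)))%:E = mu (Q j) by rewrite fineK// ge0_fin_numE.
have mpos : (0 < fine (mu (Q j)))%R by rewrite -lte_fin mE.
have afin : average mu (Q j) (EFin \o g) \is a fin_num.
  by rewrite ge0_fin_numE//; apply: (le_lt_trans aL); rewrite ltry.
pose u := (fine (average mu (Q j) (EFin \o g)) / 2)%R.
have aE : average mu (Q j) (EFin \o g) = (2 * u)%:E.
  by rewrite /u mulrCA mulfV// mulr1 fineK.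
have u0 : (0 <= u)%R by rewrite -(@pmulr_rge0 _ 2)// -lee_fin -aE.
have px0 : (0 <= p x / q)%R by rewrite (le_trans ler01).
rewrite aE poweR_EFin powRM// [in leLHS]EFinM.
have pow2 : (2 `^ (p x / q) <= 2 `^ P)%R by apply: ler_powR; rewrite ?ler1n.
rewrite [in leRHS]EFinM -[leRHS]muleA.
apply: (@le_trans _ _ ((2 `^ P)%:E * (u `^ (p x / q))%:E)).
  by rewrite lee_wpmul2r ?lee_fin ?powR_ge0.
apply: lee_wpmul2l; first by rewrite lee_fin powR_ge0.
have [u1|u1] := leP u 1%R.
  apply: (@le_trans _ _ 1).
    have : (u `^ (p x / q) <= 1 `^ (p x / q))%R.
      by apply: ge0_ler_powR; rewrite ?nnegrE.
    by rewrite powR1 lee_fin.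
  rewrite -[leLHS]mule1; apply: lee_pmul => //; first by rewrite lee_fin lerDl.
  by rewrite leeDl.
have upos : (0 < u)%R by exact: lt_trans u1.
have uL : (u <= L * M ^+ lev j)%R.
  by rewrite -lee_fin (le_trans _ aL)// aE lee_fin mulr_natl mulr2n lerDl.
have trunc_u : u%:E * mu (Q j) <= \int[mu]_(y in Q j) truncation u (EFin \o g) y.
  by apply: truncated_average => //; [exact/measurable_EFinP|rewrite aE].
have trunc_pow : \int[mu]_(y in Q j) truncation u (EFin \o g) y <=
    (const * u `^ (1 - p x / q))%:E * \int[mu]_(y in Q j) (pow g y)%:E.
  rewrite -ge0_integralZl//; last 2 first.
  - by apply/measurable_EFinP/measurable_funTS; exact: mpow.
  - by rewrite lee_fin mulr_ge0 ?powR_ge0.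
  apply: le_lower_integral => y jy; first by rewrite truncation_ge0// => z; rewrite lee_fin.
  rewrite /truncation /= lte_fin; case: ifPn => ug; last first.
    by rewrite mule_ge0// lee_fin mulr_ge0 ?powR_ge0.
  rewrite -EFinM lee_fin.
  have gpos : (0 < g y)%R by exact: lt_trans ug.
  have -> : g y = (g y `^ (1 - p y / q) * pow g y)%R.
    by rewrite /pow -powRD ?subrK ?powRr1// (gt_eqF gpos) implybT.
  rewrite ler_wpM2r ?powR_ge0//.
  apply: (@le_trans _ _ (u `^ (1 - p y / q))%R).
    rewrite -[X in (_ `^ X)%R]opprB -[X in (_ <= _ `^ X)%R]opprB !powRN.
    rewrite lef_pV2 ?posrE ?powR_gt0//.
    by apply: ge0_ler_powR; rewrite ?nnegrE ?subr_ge0 ?(ltW ug) ?(ltW gpos).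
  have -> : (1 - p y / q = (p x - p y) / q + (1 - p x / q))%R.
    by rewrite mulrBl; ring.
  rewrite powRD ?(gt_eqF upos) ?implybT//.
  by rewrite ler_wpM2r ?powR_ge0//; apply: oscillation_power jx jy _ uL; exact: ltW.
have := le_trans trunc_u trunc_pow.
set J := \int[mu]_(y in Q j) (pow g y)%:E => hJ.
have avgJ : average mu (Q j) (fun y => (pow g y)%:E) = (fine (mu (Q j)))^-1%:E * J.
  by rewrite averageE.
apply: (@le_trans _ _ (const%:E * average mu (Q j) (fun y => (pow g y)%:E))); last first.
  by apply: lee_pmul; rewrite ?lee_fin// ?lerDr// leeDr.
rewrite avgJ muleCA lee_pdivlMl// mE.
have ut : (u `^ (p x / q - 1) * u = u `^ (p x / q))%R.
  by rewrite mulrC mulr_powRB1// (lt_le_trans ltr01).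
apply: (@le_trans _ _ ((u `^ (p x / q - 1))%:E * (u%:E * mu (Q j)))).
  by rewrite muleA -EFinM ut muleC.
apply: (le_trans (lee_wpmul2l _ hJ)); first by rewrite lee_fin powR_ge0.
rewrite muleA -EFinM mulrCA -powRD ?(gt_eqF upos) ?implybT//.
by rewrite addrA subrK subrr powRr0 mulr1.
Qed.

Hypothesis Woo : \int[mu]_x (w x)%:E < +oo.
Variable C3 : R.
Hypothesis C30 : (0 <= C3)%R.
Hypothesis constant_exponent : forall G : T -> \bar R,
  measurable_fun setT G -> (forall x, 0 <= G x) ->
  \int[mu]_x (family_maximal mu Q G x `^ q * (w x)%:E) <=
  C3%:E * (1 + \int[mu]_x (G x `^ q * (w x)%:E)).

(** The reduction to the constant exponent [q]: raised to the power [p x / q],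
    the maximal function of [g] is controlled by the one of [pow g], and
    [pow g `^ q = g `^ p]. *)
Lemma variable_exponent_bound : exists2 C0 : R, (0 <= C0)%R &
  forall g : T -> R, measurable_fun setT g -> (forall x, (0 <= g x)%R) ->
  \int[mu]_x (g x `^ p x * w x)%:E <= 1 ->
  \int[mu]_x (family_maximal mu Q (EFin \o g) x `^ p x * (w x)%:E) <= C0%:E.
Proof.
set c : R := (2 `^ P * (1 + const))%R.
have c0 : (0 <= c)%R by rewrite mulr_ge0 ?powR_ge0// addr_ge0.
have WE : (fine (\int[mu]_x (w x)%:E))%:E = \int[mu]_x (w x)%:E.
  by rewrite fineK// ge0_fin_numE// integral_ge0// => x _; rewrite lee_fin ltW.
have W0 : (0 <= fine (\int[mu]_x (w x)%:E))%R.
  by apply: fine_ge0; apply: integral_ge0 => x _; rewrite lee_fin ltW.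
exists (c `^ q * 2 `^ q * (fine (\int[mu]_x (w x)%:E) + C3 * 2))%R.
  by rewrite !mulr_ge0 ?powR_ge0// addr_ge0// mulr_ge0.
move=> g mg g0 g1.
pose G : T -> \bar R := EFin \o pow g.
have G0 x : 0 <= G x by rewrite lee_fin powR_ge0.
have mG : measurable_fun setT G by apply/measurable_EFinP; exact: mpow.
have fG0 x : 0 <= family_maximal mu Q G x by exact: family_maximal_ge0.
have mfG : measurable_fun setT (fun x => family_maximal mu Q G x `^ q * (w x)%:E).
  apply: emeasurable_funM; last exact/measurable_EFinP.
  by apply: (measurableT_comp (measurable_poweR _)); exact: measurable_family_maximal.
have pointwise x : family_maximal mu Q (EFin \o g) x `^ p x <=
    (c%:E * (1 + family_maximal mu Q G x)) `^ q.
  have t0 : (0 < p x / q)%R by rewrite divr_gt0.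
  have cG : 0 <= c%:E * (1 + family_maximal mu Q G x).
    by rewrite mule_ge0 ?lee_fin// adde_ge0.
  have -> : p x = (p x / q * q)%R by rewrite divfK// gt_eqF.
  rewrite poweRrM; apply: gt0_ler_poweR;
    rewrite ?in_itv/= ?leey ?andbT ?poweR_ge0 ?(ltW q0)//.
  have fg0 : 0 <= family_maximal mu Q (EFin \o g) x.
    by apply: family_maximal_ge0 => y; rewrite lee_fin.
  have le1 : family_maximal mu Q (EFin \o g) x <=
      (c%:E * (1 + family_maximal mu Q G x)) `^ (p x / q)^-1.
    apply: family_maximal_le; first exact: poweR_ge0.
    move=> j jx; have a0 : 0 <= average mu (Q j) (EFin \o g).
      by apply: average_ge0 => y; rewrite lee_fin.
    rewrite [leLHS](poweR_root a0 t0).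
    apply: gt0_ler_poweR;
      rewrite ?in_itv/= ?leey ?andbT ?invr_ge0 ?poweR_ge0 ?(ltW t0)//.
    apply: (le_trans (average_pow_le mg g0 g1 jx)).
    apply: lee_wpmul2l; first by rewrite lee_fin.
    apply: leeD2l; exact: average_le_family_maximal.
  rewrite [leRHS](_ : _ = ((c%:E * (1 + family_maximal mu Q G x)) `^ (p x / q)^-1)
      `^ (p x / q)); last by rewrite -poweRrM mulVf ?gt_eqF// poweRe1.
  by apply: gt0_ler_poweR; rewrite ?in_itv/= ?leey ?andbT ?poweR_ge0 ?(ltW t0).
have sum_pow (y : \bar R) : 0 <= y -> (1 + y) `^ q <= (2 `^ q)%:E * (1 + y `^ q).
  move=> y0; have mono a b : 0 <= a -> a <= b -> a `^ q <= b `^ q.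
    move=> a0 ab; have b0 := le_trans a0 ab.
    by apply: gt0_ler_poweR; rewrite ?in_itv/= ?leey ?andbT ?(ltW q0).
  have y10 : 0 <= 1 + y by rewrite adde_ge0.
  have yq0 := poweR_ge0 y q.
  have [y1|y1] := leP y 1.
    apply: (@le_trans _ _ ((2 `^ q)%:E * 1)); last first.
      by apply: lee_wpmul2l; rewrite ?lee_fin ?powR_ge0// leeDl.
    rewrite mule1 -poweR_EFin; apply: mono => //.
    by rewrite (_ : 2%:E = 1 + 1)// leeD2l.
  apply: (@le_trans _ _ ((2 `^ q)%:E * y `^ q)); last first.
    by apply: lee_wpmul2l; rewrite ?lee_fin ?powR_ge0// leeDr.
  rewrite -poweR_EFin -poweRM ?lee_fin//; apply: mono => //.
  by rewrite (_ : 2%:E = 1 + 1)// ge0_muleDl// mul1e leeD2r// ltW.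
apply: (@le_trans _ _ (\int[mu]_x ((c `^ q * 2 `^ q)%:E *
    ((w x)%:E + family_maximal mu Q G x `^ q * (w x)%:E)))).
  apply: le_lower_integral => x _; first by rewrite mule_ge0 ?poweR_ge0// lee_fin ltW.
  have wx0 : 0 <= (w x)%:E by rewrite lee_fin ltW.
  apply: (@le_trans _ _ ((c%:E * (1 + family_maximal mu Q G x)) `^ q * (w x)%:E)).
    exact: lee_wpmul2r.
  have -> : (w x)%:E + family_maximal mu Q G x `^ q * (w x)%:E =
      (1 + family_maximal mu Q G x `^ q) * (w x)%:E.
    by rewrite ge0_muleDl ?poweR_ge0// mul1e.
  rewrite poweRM ?lee_fin ?adde_ge0//.
  rewrite muleA; apply: lee_wpmul2r => //.
  rewrite poweR_EFin EFinM -muleA; apply: lee_wpmul2l; rewrite ?lee_fin ?powR_ge0//.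
  exact: sum_pow.
have mEw : measurable_fun setT (EFin \o w) by exact/measurable_EFinP.
have wE0 x : 0 <= (w x)%:E by rewrite lee_fin ltW.
have fGw0 x : 0 <= family_maximal mu Q G x `^ q * (w x)%:E.
  by rewrite mule_ge0 ?poweR_ge0.
rewrite ge0_integralZl//; last 3 first.
- exact: emeasurable_funD.
- by move=> x _; rewrite adde_ge0.
- by rewrite lee_fin mulr_ge0 ?powR_ge0.
rewrite [in leRHS]EFinM; apply: lee_wpmul2l; first by rewrite lee_fin mulr_ge0 ?powR_ge0.
rewrite ge0_integralD// EFinD WE leeD2l//.
apply: (le_trans (constant_exponent mG G0)).
rewrite EFinM; apply: lee_wpmul2l; rewrite ?lee_fin//.
rewrite [leRHS](_ : _ = 1 + 1)//; apply: leeD2l.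
apply: le_trans g1; apply: le_lower_integral => x _.
  by rewrite mule_ge0 ?poweR_ge0.
by rewrite /G /= -EFinM powq.
Qed.

End variable_exponent.

(** * The weight and the weight condition *)

Section weights.
Context (R : realType) (disp : measure_display) (T : measurableType disp).
Variable mu : {measure set T -> \bar R}.

Lemma measurable_poweR2 (F : T -> \bar R) (p : T -> R) :
  measurable_fun setT F -> measurable_fun setT p ->
  (forall x, 0 <= F x)%E -> (forall x, 0 < p x) ->
  measurable_fun setT (fun x => F x `^ p x)%E.
Proof.
move=> mF mp F0 p0.
rewrite (_ : (fun _ => _) =
    fun x => if F x == +oo%E then +oo%E else (fine (F x) `^ p x)%:E).
  apply: measurable_fun_ifT => //; first exact: measurable_fun_eqe.
  apply/measurable_EFinP; apply: measurable_powR2 => //.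
  exact: measurableT_comp.
apply/funext => x; case: (F x) (F0 x) => [y _|_|]//=.
by rewrite gt_eqF// p0.
Qed.

Lemma integral_gt0 (u : T -> R) : measurable_fun setT u ->
  (forall x, 0 < u x) -> (0 < mu setT)%E -> (0 < \int[mu]_x (u x)%:E)%E.
Proof.
move=> mu_u u0 muT; rewrite lt0e integral_ge0 ?andbT; last first.
  by move=> x _; rewrite lee_fin ltW.
apply/eqP => I0; have mEu : measurable_fun setT (EFin \o u) by exact/measurable_EFinP.
have : (\int[mu]_x `|(EFin \o u) x| = 0)%E.
  rewrite -[RHS]I0; apply: eq_integral => x _.
  by rewrite /= gtr0_norm.
move/(ae_eq_integral_abs mu measurableT mEu) => [N [mN N0 sub]].
have TN : setT `<=` N.
  move=> x _; apply: sub => /= /(_ I) -[ux]; have := u0 x.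
  by rewrite ux ltxx.
have : (mu setT <= mu N)%E by apply: le_measure; rewrite ?inE.
by rewrite N0 leNgt muT.
Qed.

Variables (rho : T -> \bar R) (p : T -> R) (q : R).
Hypothesis hrho : weight mu rho.
Hypothesis mp : measurable_fun setT p.
Hypothesis q1 : 1 < q.

(** A weight is only almost everywhere positive and finite; changing it on a
    null set makes both powers below real, positive and related by duality
    at every point. *)
Definition real_weight (x : T) : R :=
  if (0 < rho x < +oo)%E then fine (rho x) else 1.

Lemma real_weight_gt0 x : 0 < real_weight x.
Proof. by rewrite /real_weight; case: ifPn => // /fine_gt0. Qed.

Lemma real_weightE x : (0 < rho x < +oo)%E -> rho x = (real_weight x)%:E.
Proof.
move=> rx; rewrite /real_weight rx fineK//.
by move: rx => /andP[r0 roo]; rewrite ge0_fin_numE// ltW.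
Qed.

Lemma measurable_real_weight : measurable_fun setT real_weight.
Proof.
have mr := weight_measurable hrho.
apply: measurable_fun_ifT => //; last exact: measurableT_comp.
apply: measurable_and; apply: (measurable_fun_bool true); rewrite setTI -[X in measurable X]setTI.
  exact: emeasurable_fun_o_infty.
exact: emeasurable_fun_infty_o.
Qed.

Definition power_weight (x : T) : R := real_weight x `^ p x.
Definition dual_weight (x : T) : R := (real_weight x `^ (p x / (q - 1)))^-1.

Lemma power_weight_gt0 x : 0 < power_weight x.
Proof. exact/powR_gt0/real_weight_gt0. Qed.

Lemma dual_weight_gt0 x : 0 < dual_weight x.
Proof. by rewrite invr_gt0; exact/powR_gt0/real_weight_gt0. Qed.

Lemma power_weight_dual x : power_weight x * dual_weight x `^ (q - 1) = 1.
Proof.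
rewrite /power_weight /dual_weight -powRN -powRrM mulNr divfK; last first.
  by rewrite subr_eq0 gt_eqF.
by rewrite powRN mulfV// gt_eqF//; exact: power_weight_gt0.
Qed.

Lemma measurable_power_weight : measurable_fun setT power_weight.
Proof. by apply: measurable_powR2 => //; exact: measurable_real_weight. Qed.

Lemma measurable_dual_weight : measurable_fun setT dual_weight.
Proof.
apply: measurable_inv_ge0 => [|x]; last exact: powR_ge0.
apply: measurable_powR2; first exact: measurable_real_weight.
exact: measurable_funM.
Qed.

Local Open Scope ereal_scope.

Let ae_weight (P : T -> Prop) :
  (forall x, 0 < rho x < +oo -> P x) -> {ae mu, forall x, P x}.
Proof. by move=> h; apply: filterS (weight_ae hrho) => x; exact: h. Qed.

Lemma power_weightE x : 0 < rho x < +oo ->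
  `|rho x| `^ p x = (power_weight x)%:E.
Proof.
by move=> rx; rewrite (real_weightE rx) /= gtr0_norm// real_weight_gt0.
Qed.

Lemma dual_weightE x : 0 < rho x < +oo ->
  (`|rho x| `^ (p x / (q - 1)%R))^-1 = (dual_weight x)%:E.
Proof.
move=> rx; rewrite (real_weightE rx) /= gtr0_norm ?real_weight_gt0//.
by rewrite inver gt_eqF//; exact/powR_gt0/real_weight_gt0.
Qed.

Lemma integral_power_weight B : measurable B ->
  \int[mu]_(x in B) (power_weight x)%:E <=
  \int[mu]_(x in B) (`|rho x| `^ p x).
Proof.
move=> mB; apply: le_ae_lower_integral => //.
- by apply/measurable_EFinP/measurable_funTS; exact: measurable_power_weight.
- by move=> x; rewrite lee_fin ltW// power_weight_gt0.
- by move=> x; exact: poweR_ge0.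
- by apply: ae_weight => x /power_weightE ->.
Qed.

Lemma integral_dual_weight B : measurable B ->
  \int[mu]_(x in B) (dual_weight x)%:E <=
  \int[mu]_(x in B) (`|rho x| `^ (p x / (q - 1)%R))^-1.
Proof.
move=> mB; apply: le_ae_lower_integral => //.
- by apply/measurable_EFinP/measurable_funTS; exact: measurable_dual_weight.
- by move=> x; rewrite lee_fin ltW// dual_weight_gt0.
- by move=> x; rewrite inve_ge0 poweR_ge0.
- by apply: ae_weight => x /dual_weightE ->.
Qed.

Lemma modular_lower (f : T -> R) (g : T -> R) (lam : R) : (0 < lam)%R ->
  measurable_fun setT g -> (forall x, (0 <= g x)%R) ->
  (forall x, f x = lam * g x)%R ->
  \int[mu]_x (g x `^ p x * power_weight x)%:E <=
  \int[mu]_x (`|rho x * (f x)%:E / lam%:E| `^ p x).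
Proof.
move=> lam0 mg g0 fE; apply: le_ae_lower_integral => //.
- apply/measurable_EFinP; apply: measurable_funM; last exact: measurable_power_weight.
  exact: measurable_powR2.
- by move=> x; rewrite lee_fin mulr_ge0 ?powR_ge0// ltW// power_weight_gt0.
- by move=> x; exact: poweR_ge0.
- apply: ae_weight => x rx; rewrite (real_weightE rx) inver gt_eqF// -!EFinM /=.
  rewrite fE mulrA mulrAC mulfK ?gt_eqF// ger0_norm; last first.
    by rewrite mulr_ge0// ltW// real_weight_gt0.
  by rewrite powRM ?(ltW (real_weight_gt0 x))// mulrC.
Qed.

(** The constant [C0] is absorbed in the norm: as [1 <= p x], dividing by
    [1 + C0] inside the power divides the integrand by at least [1 + C0]. *)
Lemma modular_upper (F N : T -> \bar R) (lam K C0 : R) :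
  (0 < lam)%R -> (0 < K)%R -> (0 <= C0)%R -> (forall x, (1 <= p x)%R) ->
  measurable_fun setT N -> (forall x, 0 <= N x) -> (forall x, 0 <= F x) ->
  (forall x, F x <= (K * lam)%:E * N x) ->
  \int[mu]_x (N x `^ p x * (power_weight x)%:E) <= C0%:E ->
  \int[mu]_x (`|rho x * F x / (K * (1 + C0) * lam)%:E| `^ p x) <= 1.
Proof.
move=> lam0 K0 C00 p1 mN N0 F0 FN hN.
have p0 x : (0 < p x)%R by exact: lt_le_trans (p1 x).
have C01 : (0 < 1 + C0)%R by rewrite ltr_pwDl.
have w0 x : (0 <= power_weight x)%R by rewrite ltW// power_weight_gt0.
have mNw : measurable_fun setT (fun x => N x `^ p x * (power_weight x)%:E).
  apply: emeasurable_funM; first exact: measurable_poweR2.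
  exact/measurable_EFinP/measurable_power_weight.
apply: (@le_trans _ _ (\int[mu]_x (((1 + C0)^-1)%:E *
    (N x `^ p x * (power_weight x)%:E)))).
  apply: ae_le_lower_integral => //.
  - by apply: emeasurable_funM.
  - by move=> x; exact: poweR_ge0.
  - by move=> x; rewrite !mule_ge0 ?poweR_ge0// lee_fin// invr_ge0 ltW.
  - apply: ae_weight => x rx; rewrite (real_weightE rx).
    have r0 := real_weight_gt0 x; set r := real_weight x in r0.
    have c0 : (0 < K * (1 + C0) * lam)%R by rewrite !mulr_gt0.
    rewrite inver gt_eqF// gee0_abs; last first.
      by rewrite !mule_ge0// lee_fin ?(ltW r0)// invr_ge0 ltW.
    apply: (@le_trans _ _ ((r%:E * (((1 + C0)^-1)%:E * N x)) `^ p x)).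
      apply: gt0_ler_poweR; rewrite ?in_itv/= ?leey ?andbT ?(ltW (p0 x))//.
      - by rewrite !mule_ge0// lee_fin ?(ltW r0)// invr_ge0 ltW.
      - by rewrite !mule_ge0// lee_fin ?(ltW r0)// invr_ge0 ltW.
      rewrite -muleA; apply: lee_wpmul2l; first by rewrite lee_fin ltW.
      rewrite muleC; have ci0 : 0 <= ((K * (1 + C0) * lam)^-1)%:E.
        by rewrite lee_fin invr_ge0 ltW.
      apply: (le_trans (lee_wpmul2l ci0 (FN x))).
      rewrite muleA -EFinM (_ : (_ * (K * lam) = (1 + C0)^-1)%R)//.
      by field; rewrite !gt_eqF.
    rewrite !poweRM ?lee_fin ?(ltW r0) ?invr_ge0 ?(ltW C01)//; last first.
      by rewrite mule_ge0// lee_fin invr_ge0 ltW.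
    rewrite muleC -muleA; apply: lee_pmul; rewrite ?mule_ge0 ?poweR_ge0//.
    rewrite poweR_EFin lee_fin; apply: ge1r_powR => //.
    by rewrite invr_gt0 C01 invf_le1// lerDl.
rewrite ge0_integralZl//; last 2 first.
- by move=> x _; rewrite mule_ge0 ?poweR_ge0// lee_fin.
- by rewrite lee_fin invr_ge0 ltW.
rewrite lee_pdivrMl// mule1; apply: (le_trans hN).
by rewrite lee_fin lerDr.
Qed.

End weights.

Section weight_condition.
Context (R : realType) (disp : measure_display) (X : measurableType disp).
Variables (d : X -> X -> R) (mu : {measure set X -> \bar R}).
Variables (p : X -> R) (rho : X -> \bar R).
Hypothesis mball : forall x r, measurable (qball d x r).
Hypothesis muball : forall x r, 0 < r -> (0 < mu (qball d x r) < +oo)%E.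
Hypothesis q1 : 1 < pminus p.
Hypothesis mp : measurable_fun setT p.
Hypothesis hrho : weight mu rho.
Hypothesis hA : (weight_const d mu p rho < +oo)%E.

Let w := power_weight rho p.
Let sg := dual_weight rho p (pminus p).
Local Open Scope ereal_scope.

Let I_ge0 (u : X -> R) B : (forall x, (0 < u x)%R) -> 0 <= \int[mu]_(x in B) (u x)%:E.
Proof. by move=> u0; apply: integral_ge0 => x _; rewrite lee_fin ltW. Qed.

Let w0 : forall x, (0 < w x)%R. Proof. exact: power_weight_gt0. Qed.
Let sg0 : forall x, (0 < sg x)%R. Proof. exact: dual_weight_gt0. Qed.
Let q10 : (0 < pminus p - 1)%R. Proof. by rewrite subr_gt0. Qed.

Let weight_const_ball x r : (0 < r)%R ->
  average mu (qball d x r) (EFin \o w) *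
  average mu (qball d x r) (EFin \o sg) `^ (pminus p - 1)%R <=
  weight_const d mu p rho.
Proof.
move=> r0; apply: (@le_trans _ _
  (average mu (qball d x r) (fun y => `|rho y| `^ p y) *
   average mu (qball d x r)
     (fun y => (`|rho y| `^ (p y / (pminus p - 1)%R))^-1) `^ (pminus p - 1)%R)); last first.
  by apply: ereal_sup_ubound; exists (x, r).
have avg u v : (forall y, (0 < u y)%R) ->
    \int[mu]_(y in qball d x r) (u y)%:E <= \int[mu]_(y in qball d x r) v y ->
    average mu (qball d x r) (EFin \o u) <= average mu (qball d x r) v.
  by move=> u0 uv; apply: lee_wpmul2l => //; rewrite inve_ge0.
have avg0 u : (forall y, (0 < u y)%R) -> 0 <= average mu (qball d x r) (EFin \o u).
  by move=> u0; apply: average_ge0 => y; rewrite lee_fin ltW.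
apply: lee_pmul; rewrite ?avg0 ?poweR_ge0//.
  by apply: avg => //; exact: integral_power_weight.
have le1 := avg sg _ sg0 (integral_dual_weight (pminus p) hrho mp (mball x r)).
by apply: gt0_ler_poweR; rewrite ?in_itv/= ?leey ?andbT ?(ltW q10) ?avg0// (le_trans (avg0 _ sg0) le1).
Qed.

(** A product of positive factors is finite only if both are, so the condition
    on a ball that fills the space makes both weights integrable. *)
Lemma weight_integrals_lty x r : (0 < r)%R -> qball d x r = setT ->
  \int[mu]_y (w y)%:E < +oo /\ \int[mu]_y (sg y)%:E < +oo.
Proof.
move=> r0 BT; have := weight_const_ball x r0; have := muball x r0; rewrite BT => muT.
have /andP[m0 moo] := muT.
have mi0 : (0 < (fine (mu setT))^-1)%R by rewrite invr_gt0 fine_gt0// m0.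
move=> /le_lt_trans /(_ hA); rewrite !averageE//.
have W0 : 0 < \int[mu]_y (w y)%:E.
  by apply: integral_gt0 => //; exact: (measurable_power_weight hrho mp).
have S0 : 0 < \int[mu]_y (sg y)%:E.
  by apply: integral_gt0 => //; exact: (measurable_dual_weight (pminus p) hrho mp).
rewrite -[\int[mu]_(y in _) (EFin \o w) y]/(\int[mu]_y (w y)%:E).
rewrite -[\int[mu]_(y in _) (EFin \o sg) y]/(\int[mu]_y (sg y)%:E) => fin.
split; rewrite ltey; apply/eqP => Ioo; move: fin; rewrite Ioo ltNge => /negP; apply.
- rewrite gt0_muley ?lte_fin// gt0_mulye// poweR_gt0// mule_gt0//.
- rewrite gt0_muley ?lte_fin// poweRyr ?gt_eqF// gt0_muley// mule_gt0//.
Qed.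

Lemma weight_condition_ball : exists2 A : R, (0 <= A)%R & forall x r, (0 < r)%R ->
  \int[mu]_(y in qball d x r) (w y)%:E < +oo ->
  \int[mu]_(y in qball d x r) (sg y)%:E < +oo ->
  (fine (\int[mu]_(y in qball d x r) (w y)%:E) *
   fine (\int[mu]_(y in qball d x r) (sg y)%:E) `^ (pminus p - 1) <=
   A * fine (mu (qball d x r)) `^ pminus p)%R.
Proof.
exists (`|fine (weight_const d mu p rho)|)%R; first exact: normr_ge0.
move=> x r r0 Woo Soo; have muB := muball x r0; have /andP[m0 moo] := muB.
have := weight_const_ball x r0; rewrite !averageE//.
set a := \int[mu]_(y in qball d x r) (EFin \o w) y.
set b := \int[mu]_(y in qball d x r) (EFin \o sg) y.
have mpos : (0 < fine (mu (qball d x r)))%R by rewrite fine_gt0// m0.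
have aE : (fine a)%:E = a by rewrite fineK// ge0_fin_numE//; exact: I_ge0.
have bE : (fine b)%:E = b by rewrite fineK// ge0_fin_numE//; exact: I_ge0.
have b0 : (0 <= fine b)%R by apply: fine_ge0; exact: I_ge0.
rewrite -{1}aE -{1}bE -!EFinM => h.
have AE : (fine (weight_const d mu p rho))%:E = weight_const d mu p rho.
  by rewrite fineK// fin_numElt hA andbT (lt_le_trans _ h)// ltNyr.
move: h; rewrite -AE lee_fin => /le_trans /(_ (ler_norm _)).
rewrite -/a -/b; move: (fine (mu _)) (fine a) (fine b) mpos b0 => m a' b' mpos b0'.
rewrite powRM ?invr_ge0 ?(ltW mpos)// -[X in (X `^ _)%R]powR_inv1 ?(ltW mpos)//.
rewrite -powRrM mulN1r powRN => h.
rewrite -(mulr_powRB1 (ltW mpos) (lt_trans ltr01 q1)).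
rewrite -ler_pdivrMr ?mulr_gt0 ?powR_gt0//; apply: le_trans h.
by rewrite le_eqVlt; apply/orP; left; apply/eqP; field; rewrite !gt_eqF ?powR_gt0.
Qed.

End weight_condition.

(** * Boundedness of the maximal operator *)

Section maximal_majorant.
Context (R : realType) (disp : measure_display) (X : measurableType disp).
Variables (d : X -> X -> R) (mu : {measure set X -> \bar R}) (Q : nat -> set X).
Variable K : R.
Hypothesis K0 : 0 < K.
Hypothesis mQ : forall j, measurable (Q j).
Hypothesis muQ : forall j, (0 < mu (Q j) < +oo)%E.
Hypothesis muball : forall x r, 0 < r -> (0 < mu (qball d x r) < +oo)%E.
Hypothesis ballQ : forall x r, 0 < r ->
  exists j, [/\ Q j x, qball d x r `<=` Q j &
    (mu (Q j) <= K%:E * mu (qball d x r))%E].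

Local Open Scope ereal_scope.

(** Replacing a ball by the cell that contains it loses the factor [K], by which
    the measures differ. *)
Lemma maximal_le_family (f : X -> R[i]) (g : X -> R) (lam : R) x :
  (0 < lam)%R -> measurable_fun setT g -> (forall x, (0 <= g x)%R) ->
  (forall y, cabs f y = (lam * g y)%:E) ->
  maximal d mu f x <= (K * lam)%:E * family_maximal mu Q (EFin \o g) x.
Proof.
move=> lam0 mg g0 fE; apply: ge_ereal_sup => _ [r /= r0 <-].
have [j [jx Bj muj]] := ballQ x r0.
have /andP[B0 Boo] := muball x r0; have /andP[m0 moo] := muQ j.
have mpos : (0 < fine (mu (Q j)))%R by rewrite fine_gt0// m0.
have bpos : (0 < fine (mu (qball d x r)))%R by rewrite fine_gt0// B0.
have Kl0 : (0 <= K * lam)%R by rewrite mulr_ge0 ?ltW.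
apply: (@le_trans _ _ ((K * lam)%:E * average mu (Q j) (EFin \o g))); last first.
  by apply: lee_wpmul2l; rewrite ?lee_fin//; exact: average_le_family_maximal.
rewrite !averageE ?B0 ?m0//.
have intE : \int[mu]_(y in Q j) (cabs f y) = lam%:E * \int[mu]_(y in Q j) (g y)%:E.
  rewrite -ge0_integralZl//; last 3 first.
  - by apply/measurable_EFinP; exact: measurable_funTS.
  - by move=> y _; rewrite lee_fin.
  - by rewrite lee_fin ltW.
  by apply: eq_integral => y _; rewrite fE.
apply: (@le_trans _ _ ((fine (mu (qball d x r)))^-1%:E *
    \int[mu]_(y in Q j) (cabs f y))).
  apply: lee_wpmul2l; first by rewrite lee_fin invr_ge0 ltW.
  apply: le_lower_integral_set => // y.
  by rewrite fE lee_fin mulr_ge0// ltW.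
rewrite intE !muleA -!EFinM; apply: lee_wpmul2r.
  by apply: integral_ge0 => y _; rewrite lee_fin.
rewrite lee_fin mulrAC ler_wpM2r ?(ltW lam0)//.
rewrite ler_pdivlMr// ler_pdivrMl// mulrC.
rewrite -lee_fin EFinM !fineK// ?ge0_fin_numE//.
Qed.

End maximal_majorant.

Lemma measurable_normc (R : realType) (disp : measure_display)
    (T : measurableType disp) (f : T -> R[i]) :
  measurable_fun setT (fun x => complex.Re (f x)) ->
  measurable_fun setT (fun x => complex.Im (f x)) ->
  measurable_fun setT (fun x => ComplexField.Normc.normc (f x)).
Proof.
move=> mRe mIm; rewrite (_ : (fun _ => _) = Num.sqrt \o
  (fun x => complex.Re (f x) ^+ 2 + complex.Im (f x) ^+ 2)); last first.
  by apply/funext => x /=; case: (f x).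
apply: measurableT_comp.
  by apply: continuous_measurable_fun => x; exact: sqrt_continuous.
by apply: measurable_funD; exact: measurable_funX.
Qed.

Lemma normc_ge0 (R : realType) (z : R[i]) : 0 <= ComplexField.Normc.normc z.
Proof. by case: z => a b /=; exact: sqrtr_ge0. Qed.

Theorem theoremA (R : realType) (disp : measure_display)
    (X : measurableType disp) (d : X -> X -> R)
    (mu : {measure set X -> \bar R}) (p : X -> R) (rho : X -> \bar R)
    (hX : homogeneous_space d mu) (hbounded : (diam d < +oo)%E)
    (hp : log_exponent d p) (hrho : weight mu rho)
    (hA : (weight_const d mu p rho < +oo)%E) :
  exists2 C : R, 0 < C &
    forall f : X -> R[i], Lpvar mu p rho f ->
      (luxnorm mu p rho (maximal d mu f) <= C%:E * luxnorm mu p rho (cabs f))%E.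
Proof.
case: hX => -[d_ge0 d_eq0 d_sym [c0 c01 d_tri]] _ mball muball [C' doubling'].
case: hp => mp _ q1 prange [A A0 plog].
pose q := pminus p.
have [x0 _] : exists x : X, True.
  apply: contrapT => noX; move: q1; rewrite /pminus (_ : range p = set0).
    by rewrite inf0 ltr10.
  by apply/seteqP; split => // y [x _ _]; apply: noX; exists x.
(* The added 1 makes [D] a strict bound of the distances. *)
pose D := fine (diam d) + 1.
have diam0 : (0 <= diam d)%E.
  apply: ereal_sup_ubound; exists (x0, x0) => //=.
  by rewrite (d_eq0 x0 x0).2.
have diamE : ((fine (diam d))%:E = diam d)%E by rewrite fineK// ge0_fin_numE.
have dD x y : d x y < D.
  rewrite /D ltr_pwDr// -lee_fin diamE; apply: ereal_sup_ubound.
  by exists (x, y).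
have D0 : 0 < D by apply: le_lt_trans (dD x0 x0); exact: d_ge0.
pose C := Num.max 1 C'.
have C1 : 1 <= C by rewrite le_max lexx.
have doubling x r : 0 < r -> (mu (qball d x (2 * r)) <= C%:E * mu (qball d x r))%E.
  move=> r0; apply: (le_trans (doubling' _ _ r0)); apply: lee_wpmul2r => //.
  by rewrite lee_fin le_max lexx orbT.
have d_eq x y : d x y = 0 -> x = y by move=> /d_eq0.
have [c [lev centers]] :=
  exists_centers d_sym c01 d_tri mball muball C1 doubling D0 dD x0.
pose Q := cell d c0 D c lev; pose Qs := enlarged_cell d c0 D c lev.
have mQ j : measurable (Q j) by exact: mball.
have mQs j : measurable (Qs j) by exact: mball.
have c00 : 0 < c0 by exact: lt_le_trans c01.
have rQ j : 0 < 2 * c0 * scale D (lev j) by rewrite !mulr_gt0// scale_gt0.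
have rQs j : 0 < 6 * c0 ^+ 3 * scale D (lev j).
  by rewrite !mulr_gt0 ?exprn_gt0// scale_gt0.
have muQ j : (0 < mu (Q j) < +oo)%E by exact: muball.
have Qsub j : Q j `<=` Qs j by exact: cell_sub_enlarged.
have Qmeet i j : (lev j <= lev i)%N -> Q i `&` Q j !=set0 -> Q i `<=` Qs j.
  exact: cell_meet.
have [K K0 muQs] := mu_enlarged_cell c01 mball C1 doubling D0 c lev.
have [K' K'0 ballQ] := ball_in_cell d_sym c01 d_tri mball C1 doubling D0 dD centers.
have mu_lower := mu_cell_lower c01 mball C1 doubling D0 dD c lev.
have qp x : q <= p x <= pplus p by exact: prange.
have pP x y : `|p x - p y| <= pplus p - q.
  have /andP[a b] := qp x; have /andP[a' b'] := qp y.
  by rewrite ler_norml; apply/andP; split; lra.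
have [H _ osc] := @cell_oscillation _ _ _ _ _ D d_ge0 d_eq d_sym c01 d_tri c lev _ _ _ A0 pP plog.
have DT : qball d x0 D = setT by exact: qball_setT.
have muT : (0 < mu setT < +oo)%E by rewrite -DT; exact: muball.
pose w := power_weight rho p; pose sg := dual_weight rho p q.
have [Woo Soo] := weight_integrals_lty mball muball q1 mp hrho hA D0 DT.
have [a a0 Aball] := weight_condition_ball mball muball q1 mp hrho hA.
have w0 x : 0 < w x by exact: power_weight_gt0.
have sg0 x : 0 < sg x by exact: dual_weight_gt0.
have mw : measurable_fun setT w by exact: (measurable_power_weight hrho).
have msg : measurable_fun setT sg by exact: (measurable_dual_weight _ hrho).
have w_sg x : w x * sg x `^ (q - 1) = 1 by exact: power_weight_dual.
have sub_lty (u : X -> R) B : (forall x, 0 < u x) ->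
    (\int[mu]_x (u x)%:E < +oo)%E -> (\int[mu]_(x in B) (u x)%:E < +oo)%E.
  move=> u0 /(le_lt_trans _); apply; apply: le_lower_integral_set => // x.
  by rewrite lee_fin ltW.
have [C3 C30 constant_exponent] := muckenhoupt mQ mQs Qsub Qmeet K0 muQs muQ
  (mw := mw) (msg := msg) (w0 := w0) (sg0 := sg0) q1 w_sg Woo Soo a0
  (fun j => Aball _ _ (rQ j) (sub_lty w _ w0 Woo) (sub_lty sg _ sg0 Soo))
  (fun j => Aball _ _ (rQs j) (sub_lty w _ w0 Woo) (sub_lty sg _ sg0 Soo)).
have [C0 C00 bound] := variable_exponent_bound mQ muQ muT mw msg mp w0 sg0 q1
  w_sg qp C1 mu_lower osc Soo Woo C30 constant_exponent.
have C01 : 0 < 1 + C0 by rewrite ltr_pwDl.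
exists (K' * (1 + C0)); first by rewrite mulr_gt0.
move=> f [mRe mIm _]; rewrite -lee_pdivrMl ?mulr_gt0//.
apply: le_ereal_inf_tmp => _ [lam [lam0 flam] <-].
rewrite lee_pdivrMl ?mulr_gt0// -EFinM.
apply: ereal_inf_lbound; exists (K' * (1 + C0) * lam) => //.
split; first by rewrite !mulr_gt0.
pose g x := ComplexField.Normc.normc (f x) / lam.
have mg : measurable_fun setT g.
  by apply: measurable_funM => //; exact: measurable_normc.
have g0 x : 0 <= g x by rewrite divr_ge0 ?normc_ge0// ltW.
have fE x : ComplexField.Normc.normc (f x) = lam * g x.
  by rewrite /g mulrCA mulfV ?mulr1// gt_eqF.
have g1 : (\int[mu]_x (g x `^ p x * w x)%:E <= 1)%E.
  exact: le_trans (modular_lower hrho mp lam0 mg g0 fE) flam.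
apply: (modular_upper hrho mp lam0 K'0 C00 _ _ _ _ _ (bound g mg g0 g1)).
- by move=> x; rewrite (le_trans (ltW q1))//; have /andP[] := qp x.
- by apply: measurable_family_maximal => // x; rewrite lee_fin.
- by move=> x; apply: family_maximal_ge0 => y; rewrite lee_fin.
- move=> x; apply: (@le_trans _ _ (average mu (qball d x 1) (cabs f))).
    by apply: average_ge0 => y; rewrite lee_fin normc_ge0.
  by apply: ereal_sup_ubound; exists 1 => /=.
- move=> x; apply: maximal_le_family => // y.
  by rewrite /cabs fE.
Qed.
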